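(* There exist universal constants $c,C>0$ such that the following holds. Let $X_i:\Omega\to\Theta$, $1\leq i\leq m$, be independent random variables with values in a measurable space $\Theta$, and let $\mathcal{F}$ be a finite nonempty set of real-valued measurable functions on $\Theta$ such that $f(X_i)$ is subgaussian for all $f\in\mathcal{F}$ and $1\leq i\leq m$. Set $$Z(f)=\Big|\frac1m\sum_{i=1}^m\big(f^2(X_i)-\mathbb{E}f^2(X_i)\big)\Big|\qquad(f\in\mathcal{F}).$$ Suppose that $\sigma,K>0$ are such that $$\sup_{f\in\mathcal{F}}\frac1m\sum_{i=1}^m\mathbb{E}|f^2(X_i)-\mathbb{E}f^2(X_i)|^q\leq\frac{q!}{2}\sigma^2K^{q-2}\qquad(q=2,3,\ldots).$$ Then, for any $u\geq 1$, $$\mathbb{P}\Big(\sup_{f\in\mathcal{F}}Z(f)\geq C\Big(\frac1m\gamma_2^2(\mathcal{F},d_{\psi_2})+\frac{\bar\Delta_{\psi_2}(\mathcal{F})}{\sqrt m}\gamma_2(\mathcal{F},d_{\psi_2})\Big)+c\Big(\sqrt u\,\frac{\sigma}{\sqrt m}+u\,\frac Km\Big)\Big)\leq e^{-u}.$$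
   Context: For a random variable $X$, $\|X\|_{\psi_2}=\inf\{a>0:\mathbb{E}\exp(|X|^2/a^2)-1\leq 1\}$; $X$ is subgaussian if $\|X\|_{\psi_2}<\infty$. Here $f^2(X_i)=(f(X_i))^2$. The semi-metric on $\mathcal{F}$ is $d_{\psi_2}(f,g)=\max_{1\leq i\leq m}\|f(X_i)-g(X_i)\|_{\psi_2}$ and the radius is $\bar\Delta_{\psi_2}(\mathcal{F})=\sup_{f\in\mathcal{F}}\max_{1\leq i\leq m}\|f(X_i)\|_{\psi_2}$. A sequence $(\mathcal{F}_n)_{n\geq 0}$ of nonempty subsets of $\mathcal{F}$ is admissible if $|\mathcal{F}_0|=1$ and $|\mathcal{F}_n|\leq 2^{2^n}$ for $n\geq 1$, and $\gamma_2(\mathcal{F},d)=\inf\sup_{f\in\mathcal{F}}\sum_{n\geq 0}2^{n/2}d(f,\mathcal{F}_n)$ with $d(f,\mathcal{F}_n)=\inf_{g\in\mathcal{F}_n}d(f,g)$, the infimum being over admissible sequences; $\gamma_2^2$ is its square. *)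

(* Defs.v *)
From HB Require Import structures.
From mathcomp Require Import all_boot all_order all_algebra.
From mathcomp Require Import all_classical all_reals all_analysis.

Set Implicit Arguments.
Unset Strict Implicit.
Unset Printing Implicit Defensive.

Import Order.TTheory GRing.Theory Num.Theory.
Import numFieldNormedType.Exports.

Local Open Scope classical_set_scope.
Local Open Scope ring_scope.
Local Open Scope ereal_scope.

Section generic_chaining.
Context {R : realType} {T : Type}.
Implicit Types (F : set T) (d : T -> T -> \bar R).

Definition admissible F (Fn : nat -> set T) : Prop :=
  [/\ forall n, Fn n `<=` F,
      forall n, Fn n !=set0,
      (Fn 0%N #= `I_1)%card &
      forall n, (1 <= n)%N -> (Fn n #<= `I_(2 ^ (2 ^ n)))%card].

Definition dist_to d (f : T) (G : set T) : \bar R :=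
  ereal_inf [set d f g | g in G].

Definition gamma2 F d : \bar R :=
  ereal_inf [set ereal_sup
      [set \sum_(0 <= n <oo) (2 `^ (n%:R / 2))%:E * dist_to d f (Fn n)
         | f in F]
    | Fn in [set Fn | admissible F Fn]].

End generic_chaining.

Section subgaussian.
Context {d : measure_display} {Omega : measurableType d} {R : realType}.
Variable P : probability Omega R.

(* The infimum of the empty set is +oo, so the norm is total. *)
Definition psi2_norm (Y : Omega -> R) : \bar R :=
  ereal_inf [set a%:E | a in [set a : R | (0 < a)%R /\
    'E_P[fun w => expR (`|Y w|%R ^+ 2 / a ^+ 2)] - 1 <= 1]].

Definition subgaussian (Y : Omega -> R) : Prop := psi2_norm Y < +oo.

End subgaussian.

Section random_sample.
Context {d d' : measure_display} {Omega : measurableType d}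
  {Theta : measurableType d'} {R : realType}.
Variables (P : probability Omega R) (m : nat) (X : 'I_m -> {RV P >-> Theta}).

Definition independent_RVs : Prop :=
  forall (J : {set 'I_m}) (B : 'I_m -> set Theta),
    (forall i, i \in J -> measurable (B i)) ->
    P (\bigcap_(i in [set` J]) (X i @^-1` B i)) =
    \prod_(i in J) P (X i @^-1` B i).

(* psi2_norm is nonnegative, so 0 is a neutral starting value for the maxima
   below as soon as m > 0. *)
Definition psi2_dist (f g : Theta -> R) : \bar R :=
  \big[maxe/0]_(i < m) psi2_norm P (fun w => f (X i w) - g (X i w))%R.

Definition psi2_radius (F : set (Theta -> R)) : \bar R :=
  ereal_sup [set \big[maxe/0]_(i < m) psi2_norm P (fun w => f (X i w)) | f in F].

(* For subgaussian f (X i) the second moment is finite, and fine is harmless. *)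
Definition second_moment (f : Theta -> R) (i : 'I_m) : R :=
  fine 'E_P[fun w => (f (X i w) ^+ 2)%R].

Definition sq_deviation (f : Theta -> R) (w : Omega) : R :=
  `| m%:R^-1 * \sum_(i < m) (f (X i w) ^+ 2 - second_moment f i) |%R.

End random_sample.

(* Main.v *)
(**
  Let [T f] be the unnormalised deviation [sum_i (f(X_i)^2 - E f(X_i)^2)].
  Choose [l] with [u <= 2^l <= 2u] and start the generic chaining at level [l]:
  the at most [2^(2^l)] functions of that level are handled by Bernstein's
  inequality under the moment condition and a union bound, which is why only
  [sigma] and [K] are multiplied by powers of [u].  The links of the chain at a
  level [n >= l] are treated in two ways.

  - If [2^n <= m], then [g^2 - h^2 = (g - h)(g + h)] is sub-exponential and
    Bernstein's inequality bounds [T g - T h] by a multiple of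
    [rad * sqrt m * 2^(n/2) d(g,h)].
  - If [2^n > m], then [sum_i (g - h)^2(X_i) <= 9 * 2^n d(g,h)^2] off an event of
    probability [exp(-8 * 2^n)], directly from the definition of the psi_2-norm.

  If [g] is the point of the chain of [f] where the second regime starts, the
  second kind of links gives [sum_i (f - g)^2(X_i) <= C gamma_2^2], and in
  [f^2 - g^2 = (f - g)^2 + 2 g (f - g)] the sum [sum_i g^2(X_i)] is at most
  [m rad^2 + |T g|], where [T g] is already under control.

  Infima are only approached within [eps]; the errors are absorbed in the
  strictly positive term [sqrt u * sigma / sqrt m].
*)
Require Import Defs.
From HB Require Import structures.
From mathcomp Require Import all_boot all_order all_algebra.
From mathcomp Require Import all_classical all_reals all_analysis.
From mathcomp Require Import measurable_realfun ring lra.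

Set Implicit Arguments.
Unset Strict Implicit.
Unset Printing Implicit Defensive.

Import Order.TTheory GRing.Theory Num.Theory.
Import numFieldNormedType.Exports.

Local Open Scope classical_set_scope.
Local Open Scope ring_scope.
Local Open Scope ereal_scope.

(** * Expectations of products of independent factors *)

Section independence.
Context {d d' : measure_display} {Omega : measurableType d}
  {Theta : measurableType d'} {R : realType} (P : probability Omega R).
Import HBNNSimple.

Lemma expectationE (Y : Omega -> R) : 'E_P[Y] = \int[P]_w (Y w)%:E.
Proof. by rewrite unlock. Qed.

(** Factorisation against indicators extends to simple functions by linearity and to nonnegative
    measurable [phi] by monotone convergence. Only the factorisation is asked of [G], so that [G]
    can be a product over all the other variables. *)
Lemma ge0_expectation_indep_mul (U : {RV P >-> Theta}) (G : Omega -> R)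
    (phi : Theta -> R) :
  measurable_fun setT G -> (forall w, 0 <= G w)%R -> 'E_P[G] < +oo ->
  (forall B, measurable B ->
     'E_P[fun w => \1_B (U w) * G w]%R = P (U @^-1` B) * 'E_P[G]) ->
  measurable_fun setT phi -> (forall x, 0 <= phi x)%R ->
  'E_P[fun w => phi (U w) * G w]%R = 'E_P[fun w => phi (U w)] * 'E_P[G].
Proof.
rewrite !expectationE => mG G0 Goo indep mphi phi0.
have {}indep B : measurable B ->
    \int[P]_w (\1_B (U w) * G w)%:E = P (U @^-1` B) * \int[P]_w (G w)%:E.
  by move=> /indep; rewrite expectationE.
have mU : measurable_fun setT U by [].
have mphiE : measurable_fun [set: Theta] (EFin \o phi : Theta -> \bar R).
  exact/measurable_EFinP.
have EG_fin : \int[P]_w (G w)%:E \is a fin_num.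
  by rewrite ge0_fin_numE// integral_ge0// => w _; rewrite lee_fin.
pose f_ := nnsfun_approx measurableT mphiE.
have mfU n : measurable_fun setT (fun w => f_ n (U w)).
  by apply: measurableT_comp => //.
have f_nd x : nondecreasing_seq (fun n => f_ n x).
  by move=> i j ij; exact/lefP/nd_nnsfun_approx.
have f_cvg x : (EFin \o (fun n => f_ n x)) n @[n --> \oo] --> (phi x)%:E.
  by apply: cvg_nnsfun_approx => // y _; rewrite lee_fin.
have c1 : \int[P]_w (f_ n (U w) * G w)%:E @[n --> \oo] -->
          \int[P]_w (phi (U w) * G w)%:E.
  have -> : \int[P]_w (phi (U w) * G w)%:E =
      \int[P]_w limn (fun n => (f_ n (U w) * G w)%:E).
    apply: eq_integral => w _; apply/esym/cvg_lim => //.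
    under eq_fun do rewrite EFinM.
    rewrite EFinM; apply: cvgeZr => //; exact: f_cvg.
  apply: cvg_monotone_convergence => //.
  - by move=> n; apply/measurable_EFinP/measurable_funM.
  - by move=> n w _; rewrite lee_fin mulr_ge0.
  - by move=> w _ i j ij; rewrite lee_fin ler_wpM2r//; exact: f_nd.
have c2 : \int[P]_w (f_ n (U w))%:E @[n --> \oo] --> \int[P]_w (phi (U w))%:E.
  have -> : \int[P]_w (phi (U w))%:E = \int[P]_w limn (fun n => (f_ n (U w))%:E).
    by apply: eq_integral => w _; apply/esym/cvg_lim => //; exact: f_cvg.
  apply: cvg_monotone_convergence => //.
  - by move=> n; apply/measurable_EFinP.
  - by move=> n w _; rewrite lee_fin.
  - by move=> w _ i j ij; rewrite lee_fin; exact: f_nd.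
suff f_indep n : \int[P]_w (f_ n (U w) * G w)%:E =
    \int[P]_w (f_ n (U w))%:E * \int[P]_w (G w)%:E.
  move: c1; under eq_cvg do rewrite f_indep.
  by move=> /cvg_unique; apply => //; exact: cvgeZr.
have mB k : measurable (f_ n @^-1` [set k]) by [].
(* Splitting a simple function over its level sets; the weight [H] is kept general because both
   [H = G] and [H = 1] are needed. *)
have expand (H : Omega -> R) : measurable_fun setT H -> (forall w, 0 <= H w)%R ->
    \int[P]_w (f_ n (U w) * H w)%:E =
    \sum_(k \in range (f_ n))
      k%:E * \int[P]_w (\1_(f_ n @^-1` [set k]) (U w) * H w)%:E.
  move=> mH H0.
  have m1 k : measurable_fun setT (fun w => \1_(f_ n @^-1` [set k]) (U w) : R).
    exact: measurableT_comp.
  have pos k x : (0 <= k * \1_(f_ n @^-1` [set k]) x)%R.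
    have := @nnfun_muleindic_ge0 _ _ _ (f_ n) k x.
    by rewrite lee_fin.
  transitivity (\sum_(k \in range (f_ n))
      \int[P]_w (k * (\1_(f_ n @^-1` [set k]) (U w) * H w))%:E).
    rewrite -ge0_integral_fsum//.
    - apply: eq_integral => w _; rewrite fsumEFin//; congr EFin.
      rewrite {1}(fimfunE (f_ n)) mulrC.
      rewrite !fsbig_finite//= mulr_sumr.
      by apply: eq_bigr => k _; ring.
    - move=> k; apply/measurable_EFinP/measurable_funM => //.
      exact: measurable_funM.
    - by move=> k w _; rewrite lee_fin mulrA mulr_ge0.
  apply: eq_fsbigr => k; rewrite inE => -[x _ <-].
  under eq_integral do rewrite EFinM.
  rewrite ge0_integralZl//.
  - by apply/measurable_EFinP/measurable_funM.
  - by move=> w _; rewrite lee_fin mulr_ge0.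
  - by rewrite lee_fin.
rewrite expand// .
have -> : \int[P]_w (f_ n (U w))%:E = \int[P]_w (f_ n (U w) * 1)%:E.
  by apply: eq_integral => w _; rewrite mulr1.
rewrite (expand (fun=> 1%R))// !fsbig_finite//= [RHS]muleC.
rewrite big_seq [in RHS]big_seq ge0_sume_distrr.
  apply: eq_bigr => k _; rewrite indep// [RHS]muleC -muleA; congr (_ * (_ * _)).
  under eq_integral do rewrite mulr1.
  have -> : \int[P]_x (\1_(f_ n @^-1` [set k]) (U x))%:E =
    \int[P]_x (\1_(U @^-1` (f_ n @^-1` [set k])) x)%:E by [].
  rewrite integral_indic ?setIT//.
  by rewrite -[X in measurable X]setTI; exact: mU.
move=> k kr; apply: mule_ge0; last first.
  by apply: integral_ge0 => w _; rewrite lee_fin mulr1.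
rewrite lee_fin; move: kr; rewrite in_fset_set// inE => -[x _ <-] //.
Qed.

(* The indicators are replaced by the functions phi i one index at a time. *)
Lemma expectation_prod (m : nat) (X : 'I_m -> {RV P >-> Theta})
    (phi : 'I_m -> Theta -> R) :
  independent_RVs X ->
  (forall i, measurable_fun setT (phi i)) ->
  (forall i x, 0 <= phi i x)%R ->
  (forall i, 'E_P[fun w => phi i (X i w)] < +oo) ->
  'E_P[fun w => \prod_i phi i (X i w)]%R =
  \prod_i 'E_P[fun w => phi i (X i w)].
Proof.
move=> indep mphi phi0 phioo.
(* Functions of index at least [k] are still indicators, the others are arbitrary: [k = 0] is the
   independence hypothesis, [k = m] the claim. *)
suff H : forall k (psi : 'I_m -> Theta -> R),
    (forall i, measurable_fun setT (psi i)) ->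
    (forall i x, 0 <= psi i x)%R ->
    (forall i, 'E_P[fun w => psi i (X i w)] < +oo) ->
    (forall i : 'I_m, (k <= i)%N -> exists2 B, measurable B & psi i = \1_B) ->
    'E_P[fun w => \prod_i psi i (X i w)]%R =
    \prod_i 'E_P[fun w => psi i (X i w)].
  by apply: (H m) => // i; rewrite leqNgt ltn_ord.
move=> {phi mphi phi0 phioo} k; elim: k => [|k IH] psi mpsi psi0 psioo psiB.
  have /choice[B BP] i : exists B, measurable B /\ psi i = \1_B.
    by have [//|B mB ->] := psiB i; exists B.
  have := indep [set: 'I_m]%SET B (fun i _ => (BP i).1).
  have E1 i : 'E_P[fun w => psi i (X i w)] = P (X i @^-1` B i).
    rewrite (BP i).2.
    have -> : (fun w => \1_(B i) (X i w) : R) = \1_(X i @^-1` B i) by [].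
    by rewrite expectation_indic//; apply: measurable_funPTI; exact: (BP i).1.
  under [X in _ = X -> _]eq_bigr do rewrite -E1.
  rewrite [X in _ = X -> _](eq_bigl xpredT); last by move=> i; rewrite inE.
  move=> <-; rewrite -expectation_indic; last first.
    apply: fin_bigcap_measurable => // i _.
    by apply: measurable_funPTI; exact: (BP i).1.
  congr expectation; apply/funext => w.
  rewrite indicE.
  have [h|h] := boolP (w \in _).
    move: h; rewrite inE => h; rewrite big1// => i _.
    rewrite (BP i).2 indicE mem_set//; apply: h => /=; exact: finset.in_setT.
  move: h; rewrite notin_setE => h.
  have [i Bi] : exists i, ~ B i (X i w).
    by apply/existsNP => h'; apply: h => i _; exact: h'.
  by rewrite (bigD1 i)//= (BP i).2 indicE memNset// mul0r.
have [mk|km] := leqP m k.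
  by apply: IH => // i ki; move: (leq_trans mk ki); rewrite leqNgt ltn_ord.
pose k0 := Ordinal km.
pose G w := (\prod_(i | i != k0) psi i (X i w))%R.
pose upd (f : Theta -> R) i := if i == k0 then f else psi i.
have prodE (f : Theta -> R) : (fun w => \prod_i upd f i (X i w))%R =
    (fun w => f (X k0 w) * G w)%R.
  apply/funext => w; rewrite (bigD1 k0)//= {1}/upd eqxx; congr (_ * _)%R.
  by apply: eq_bigr => i /negbTE ik; rewrite /upd ik.
(* With an indicator in position [k0], the product falls under the induction hypothesis; this is the
   factorisation that the previous lemma asks of [G]. *)
have updB B : measurable B ->
    'E_P[fun w => \1_B (X k0 w) * G w]%R =
    P (X k0 @^-1` B) * \prod_(i | i != k0) 'E_P[fun w => psi i (X i w)].
  move=> mB; rewrite -(prodE \1_B) IH.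
  - rewrite (bigD1 k0)//= {1}/upd eqxx; congr (_ * _).
      by rewrite -expectation_indic//; exact: measurable_funPTI.
    by apply: eq_bigr => i /negbTE ik; rewrite /upd ik.
  - by move=> i; rewrite /upd; case: ifP.
  - by move=> i x; rewrite /upd; case: ifP.
  - move=> i; rewrite /upd; case: ifP => // _.
    have -> : (fun w => \1_B (X i w) : R) = \1_(X i @^-1` B) by [].
    have mXB : measurable (X i @^-1` B) by exact: measurable_funPTI.
    by rewrite expectation_indic// (le_lt_trans (probability_le1 _ _))// ltry.
  - move=> i ki; rewrite /upd; case: ifPn => [_|ik]; first by exists B.
    apply: psiB; rewrite ltn_neqAle ki andbT.
    by apply: contra ik => /eqP ik; apply/eqP/val_inj.
have EG : 'E_P[G] = \prod_(i | i != k0) 'E_P[fun w => psi i (X i w)].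
  have := updB setT measurableT; rewrite preimage_setT probability_setT mul1e.
  by move=> <-; congr expectation; apply/funext => w; rewrite indicT mul1r.
have -> : (fun w => \prod_i psi i (X i w))%R = (fun w => psi k0 (X k0 w) * G w)%R.
  by apply/funext => w; rewrite (bigD1 k0).
rewrite ge0_expectation_indep_mul//.
- by rewrite EG [RHS](bigD1 k0).
- have -> : G = (fun w => \prod_i if i != k0 then psi i (X i w) else 1)%R.
    by apply/funext => w; rewrite /G big_mkcond.
  apply: measurable_prod => i _; case: (i != k0) => //.
  exact: measurableT_comp.
- by move=> w; apply: prodr_ge0.
- suff : 'E_P[G] \is a fin_num by rewrite fin_numElt => /andP[].
  rewrite EG; elim/big_ind: _ => //; first exact: fin_numM.
  by move=> i _; rewrite ge0_fin_numE// expectation_ge0.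
- by move=> B mB; rewrite updB// EG.
Qed.

End independence.

(** * Chernoff and Bernstein tails for sums of independent variables *)

Section tails.
Context {d d' : measure_display} {Omega : measurableType d}
  {Theta : measurableType d'} {R : realType} (P : probability Omega R).
Context (m : nat) (X : 'I_m -> {RV P >-> Theta}) (indepX : independent_RVs X).

Lemma le_expectation_measurable (Y Z : Omega -> R) :
  measurable_fun setT Y -> measurable_fun setT Z ->
  (forall w, 0 <= Y w)%R -> (forall w, Y w <= Z w)%R -> 'E_P[Y] <= 'E_P[Z].
Proof.
move=> mY mZ Y0 YZ; rewrite !expectationE; apply: ge0_le_integral => //.
- by move=> w _; rewrite lee_fin.
- exact/measurable_EFinP.
- exact/measurable_EFinP.
- by move=> w _; rewrite lee_fin.
Qed.

Lemma measurable_sum_RV (W : 'I_m -> Theta -> R) :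
  (forall i, measurable_fun setT (W i)) ->
  measurable_fun setT (fun w => \sum_i W i (X i w))%R.
Proof.
by move=> mW; apply: measurable_sum => i; exact: measurableT_comp.
Qed.

Lemma measurable_set_ge (Y : Omega -> R) (c : R) :
  measurable_fun setT Y -> measurable [set w | c <= Y w]%R.
Proof.
move=> mY; have := mY measurableT _ (measurable_itv `[c, +oo[).
by rewrite setTI; congr measurable; apply/seteqP; split=> w /=;
  rewrite in_itv /= andbT.
Qed.

(** Independence turns the exponential moment of the sum into a product, so the exponents [b i] add
    up. *)
Lemma chernoff_sum (W : 'I_m -> Theta -> R) (b : 'I_m -> R) (t : R) :
  (forall i, measurable_fun setT (W i)) ->
  (forall i, 'E_P[fun w => expR (W i (X i w))] <= (expR (b i))%:E) ->
  P [set w | \sum_i b i + t <= \sum_i W i (X i w)]%R <= (expR (- t))%:E.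
Proof.
move=> mW Wb; have mS := measurable_sum_RV mW.
pose S : {RV P >-> R} := HB.pack (fun w => \sum_i W i (X i w))%R
  (isMeasurableFun.Build _ _ _ _ _ mS).
have mE i : measurable_fun setT (expR \o W i) by exact: measurableT_comp.
have E0 i : 0 <= 'E_P[fun w => expR (W i (X i w))].
  by apply: expectation_ge0 => w; exact: expR_ge0.
(* The Chernoff parameter is 1: any scaling is already contained in [W]. *)
apply: le_trans (@chernoff _ _ _ P S 1%R _ ltr01) _.
rewrite mul1r /mmt_gen_fun.
have -> : expR \o 1 \o* S = (fun w => \prod_i (expR \o W i) (X i w))%R.
  by apply/funext => w /=; rewrite mulr1 expR_sum.
rewrite (@expectation_prod _ _ _ _ _ P m X (fun i => expR \o W i))//; last 2 first.
- by move=> i x; exact: expR_ge0.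
- by move=> i; apply: le_lt_trans (Wb i) _; exact: ltry.
apply: le_trans (_ : (\prod_i (expR (b i)))%:E * (expR (- (\sum_i b i + t)))%:E <= _).
  apply: lee_wpmul2r; first by rewrite lee_fin expR_ge0.
  rewrite -prodEFin.
  suff /andP[] : 0 <= \prod_i 'E_P[fun w => (expR \o W i) (X i w)] <=
      \prod_i (expR (b i))%:E by [].
  elim/big_ind2 : _ => [|x1 x2 y1 y2 /andP[? ?] /andP[? ?]|i _].
  - by rewrite lee01 lexx.
  - by rewrite mule_ge0//= lee_pmul.
  - by rewrite E0 Wb.
by rewrite -EFinM lee_fin -expR_sum -expRD opprD addNKr.
Qed.

(** Optimisation of the Chernoff bound over [|l| <= L], the range in which the log-moment generating
    function is quadratic. The exponents [b i] may differ and only their sum is bounded, because the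
    moment condition on the sample is itself an average over [i]. *)
Lemma bernstein_mgf (W : 'I_m -> Theta -> R) (v L t : R) :
  (0 < v)%R -> (0 < L)%R -> (0 < t)%R ->
  (forall i, measurable_fun setT (W i)) ->
  (forall l, (`|l| <= L)%R -> exists2 b : 'I_m -> R,
     (forall i, 'E_P[fun w => expR (l * W i (X i w))%R] <= (expR (b i))%:E) &
     (\sum_i b i <= v * l ^+ 2)%R) ->
  P [set w | 2 * Num.sqrt (v * t) + 2 * t / L <= `|\sum_i W i (X i w)|]%R
    <= (2 * expR (- t))%:E.
Proof.
move=> v0 L0 t0 mW mgf.
set s := (2 * Num.sqrt (v * t) + 2 * t / L)%R.
(* The unconstrained optimum is [sqrt t / sqrt v]. If it exceeds [L], take [l = L]; then
   [v * L ^+ 2 <= t], and the linear term [2 * t / L] pays for both. *)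
have [l [l0 lL ls]] : exists l, [/\ 0 < l, l <= L & v * l ^+ 2 + t <= l * s]%R.
  have sv : (0 < Num.sqrt v)%R by rewrite sqrtr_gt0.
  have st : (0 < Num.sqrt t)%R by rewrite sqrtr_gt0.
  have vE : (v = Num.sqrt v ^+ 2)%R by rewrite sqr_sqrtr// ltW.
  have tE : (t = Num.sqrt t ^+ 2)%R by rewrite sqr_sqrtr// ltW.
  have sE : s = (2 * (Num.sqrt v * Num.sqrt t) + 2 * t / L)%R.
    by rewrite /s sqrtrM// ltW.
  have [h|h] := leP (Num.sqrt t / Num.sqrt v)%R L.
    exists (Num.sqrt t / Num.sqrt v)%R; split => //; first exact: divr_gt0.
    rewrite sE mulrDr.
    have -> : (v * (Num.sqrt t / Num.sqrt v) ^+ 2 = t)%R.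
      by rewrite {1}vE {2}tE; field; rewrite lt0r_neq0.
    have -> : (Num.sqrt t / Num.sqrt v * (2 * (Num.sqrt v * Num.sqrt t)) = t + t)%R.
      by rewrite {3 4}tE; field; rewrite lt0r_neq0.
    by rewrite lerDl; repeat first [apply: mulr_ge0 | rewrite invr_ge0 | exact: ltW].
  exists L; split => //; rewrite sE mulrDr.
  have -> : (L * (2 * t / L) = t + t)%R by field; rewrite lt0r_neq0.
  have : (v * L ^+ 2 <= t)%R.
    rewrite ltr_pdivlMr// in h.
    rewrite vE tE -exprMn ler_sqr ?nnegrE ?mulr_ge0// ?ltW//.
    by rewrite mulrC.
  have : (0 <= L * (2 * (Num.sqrt v * Num.sqrt t)))%R.
    by rewrite !mulr_ge0// ltW.
  lra.
(* The sign [e] yields both one-sided tails, hence the final factor 2. *)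
have one e : (`|e| = 1)%R -> P [set w | s <= e * \sum_i W i (X i w)]%R
    <= (expR (- t))%:E.
  move=> e1.
  have [|b Eb sb] := mgf (l * e)%R.
    by rewrite normrM e1 mulr1 ger0_norm// ltW.
  have mlW i : measurable_fun setT (fun x => (l * e) * W i x)%R.
    exact: measurable_funM.
  have := @chernoff_sum (fun i x => l * e * W i x)%R b t mlW Eb.
  apply: le_trans; apply: le_measure; rewrite ?inE.
  - apply: measurable_set_ge; apply: measurable_funM => //.
    exact: measurable_sum_RV.
  - by apply: measurable_set_ge; exact: (measurable_sum_RV mlW).
  - move=> w /= sw; rewrite -mulr_sumr -mulrA.
    apply: le_trans (_ : l * s <= _)%R; last by rewrite ler_pM2l.
    apply: le_trans ls; rewrite lerD2r (le_trans sb)// exprMn.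
    by rewrite -[(e ^+ 2)%R]ger0_norm ?sqr_ge0// normrX e1 expr1n mulr1.
have mS e : measurable [set w | s <= e * \sum_i W i (X i w)]%R.
  apply: measurable_set_ge; apply: measurable_funM => //.
  exact: measurable_sum_RV.
apply: le_trans (_ : P ([set w | s <= 1 * \sum_i W i (X i w)]%R `|`
  [set w | s <= -1 * \sum_i W i (X i w)]%R) <= _).
  apply: le_measure; rewrite ?inE.
  - apply: measurable_set_ge; apply: measurableT_comp => //.
    exact: measurable_sum_RV.
  - exact: measurableU.
  - move=> w /=; rewrite mul1r mulN1r.
    by case: (ger0P (\sum_i W i (X i w))%R) => _ h; [left|right].
apply: le_trans (measureU2 _ _ _) _ => //.
rewrite (_ : (2 * expR (- t))%R = (expR (- t) + expR (- t))%R); last by ring.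
by rewrite EFinD leeD// one// ?normrN normr1.
Qed.

Lemma measure_bigcup_seq_le (I : eqType) (s : seq I) (E : I -> set Omega) (p : R) :
  (forall i, i \in s -> measurable (E i)) ->
  (forall i, i \in s -> P (E i) <= p%:E) ->
  P (\big[setU/set0]_(i <- s) E i) <= ((size s)%:R * p)%:E.
Proof.
elim: s => [|x s IH] mE Ep; first by rewrite big_nil measure0 mul0r.
have mEs i : i \in s -> measurable (E i).
  by move=> si; apply: mE; rewrite inE si orbT.
rewrite big_cons; apply: le_trans (measureU2 _ _ _) _.
- by apply: mE; rewrite mem_head.
- by rewrite big_seq; apply: bigsetU_measurable.
- rewrite /= -natr1 mulrDl mul1r addrC EFinD leeD//.
  + by apply: IH => // i si; apply: Ep; rewrite inE si orbT.
  + by apply: Ep; rewrite mem_head.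
Qed.

(** Each exponential moment is at most 2, hence at most [expR 1], so every summand contributes
    exponent 1 and the sum of the exponents is [m]. *)
Lemma square_sum_tail (Y : 'I_m -> Theta -> R) (D t : R) :
  (0 < D)%R ->
  (forall i, measurable_fun setT (Y i)) ->
  (forall i, 'E_P[fun w => expR (Y i (X i w) ^+ 2 / D ^+ 2)] <= 2%:E) ->
  P [set w | (m%:R + t) * D ^+ 2 <= \sum_i Y i (X i w) ^+ 2]%R
    <= (expR (- t))%:E.
Proof.
move=> D0 mY EY.
have mY2 i : measurable_fun setT (fun x => (Y i x ^+ 2 / D ^+ 2)%R).
  by apply: measurable_funM => //; exact: measurable_funX.
have := @chernoff_sum (fun i x => Y i x ^+ 2 / D ^+ 2)%R (fun=> 1%R) t mY2.
have E2 : 2%:E <= (expR 1)%:E :> \bar R.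
  rewrite lee_fin; have := @expR_ge1Dx R 1; lra.
move=> /(_ (fun i => le_trans (EY i) E2)).
rewrite (_ : [set w | _ <= _]%R =
  [set w | ((m%:R + t) * D ^+ 2 <= \sum_i Y i (X i w) ^+ 2)%R])//.
apply/seteqP; split=> w /=; rewrite sumr_const card_ord -mulr_suml;
  by rewrite ler_pdivlMr ?exprn_gt0.
Qed.

End tails.

(** * Elementary inequalities for the exponential *)

Section exponential_bounds.
Context {R : realType}.
Implicit Types x y z : R.

Lemma expR_ge_taylor2 y : (0 <= y)%R -> (1 + y + y ^+ 2 / 2 <= expR y)%R.
Proof.
move=> y0; have := @nondecreasing_cvgn_le R (series (exp_coeff y)).
move=> /(_ _ _ 3%N); rewrite /series /= !big_nat_recr//= big_geq//.
rewrite /exp_coeff/= expr0 expr1 fact0 factS fact0 divr1 add0r !factS fact0.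
rewrite !muln1 divr1 => h; apply: h; last exact: is_cvg_series_exp_coeff.
by apply: nondecreasing_series => n _ _; rewrite /exp_coeff/= divr_ge0// exprn_ge0.
Qed.

(** The tail of the exponential series at [|x|] from the quadratic term on; taking [|x|] makes it a
    bound for both signs. *)
Definition expR_rem2 x : R := (expR `|x| - 1 - `|x|)%R.

Lemma expR_rem2_ge0 x : (0 <= expR_rem2 x)%R.
Proof. by rewrite /expR_rem2; have := expR_ge1Dx `|x|%R; lra. Qed.

Lemma expR_le_rem2 x : (expR x <= 1 + x + expR_rem2 x)%R.
Proof.
rewrite /expR_rem2; have [x0|/ltW x0] := ger0P x; first lra.
have : (0 <= - x)%R by rewrite oppr_ge0.
move: (- x)%R (opprK x) => y <- {x x0} y0.
have := expR_ge_taylor2 y0; have e0 := expR_gt0 y; rewrite expRN.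
(* This bound on [expR (- y)] follows from the lower bound on [expR y], since [(1 - y + y^2/2)(1 + y
   + y^2/2) = 1 + y^4/4 >= 1]. *)
move=> h; suff : ((expR y)^-1 <= 1 - y + y ^+ 2 / 2)%R by lra.
rewrite invf_ple ?posrE//; last by nra.
apply: le_trans h; rewrite invf_ple ?posrE; [|nra|nra].
rewrite -[leLHS]mul1r ler_pdivrMr; nra.
Qed.

(** With [y = |x|], the inequality [1 - y <= expR (- y)] gives [expR y - 1 <= y * expR y]; it is
    used twice. *)
Lemma expR_rem2_le x : (expR_rem2 x <= x ^+ 2 * expR `|x|)%R.
Proof.
rewrite /expR_rem2 -[(x ^+ 2)%R]ger0_norm ?sqr_ge0// normrX.
move: `|x|%R (normr_ge0 x) => y y0.
have : (1 - y <= expR (- y))%R by exact: expR_ge1Dx.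
have e0 := expR_gt0 y; rewrite expRN => h.
have : ((1 - y) * expR y <= 1)%R by rewrite -ler_pdivlMr// mul1r.
nra.
Qed.

(** One half of [expR |x|] absorbs [expR |l * x|], the other absorbs [x ^+ 2]: the constant 8 comes
    from [(|x|/2)^2 / 2 <= expR (|x|/2)]. *)
Lemma expR_le_psi1 x l : (`|l| <= 2^-1)%R ->
  (expR (l * x) <= 1 + l * x + 8 * l ^+ 2 * expR `|x|)%R.
Proof.
move=> l2; apply: le_trans (expR_le_rem2 _) _; rewrite lerD2l.
apply: le_trans (expR_rem2_le _) _.
have n0 := normr_ge0 x.
have h1 : (expR `|l * x| <= expR (`|x| / 2))%R.
  by rewrite ler_expR normrM mulrC ler_wpM2l.
have h2 : (x ^+ 2 <= 8 * expR (`|x| / 2))%R.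
  rewrite -[(x ^+ 2)%R]ger0_norm ?sqr_ge0// normrX.
  by have := @expR_ge_taylor2 (`|x| / 2)%R; nra.
have h3 : (expR `|x| = expR (`|x| / 2) * expR (`|x| / 2))%R.
  by rewrite -expRD; congr expR; lra.
rewrite h3 exprMn [leRHS](_ : _ = l ^+ 2 * (8 * expR (`|x| / 2)) * expR (`|x| / 2))%R; last by ring.
apply: ler_pM; rewrite ?expR_ge0//.
- by rewrite mulr_ge0 ?sqr_ge0.
- by rewrite ler_wpM2l ?sqr_ge0.
Qed.

(** Lets a bound on all moments of order at least 2 be applied term by term. *)
Lemma expR_rem2_series x :
  (expR_rem2 x)%:E = \sum_(q <oo) (`|x| ^+ q.+2 / q.+2`!%:R)%:E.
Proof.
apply/esym/cvg_lim => //.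
have -> : (fun n => \sum_(0 <= q < n) (`|x| ^+ q.+2 / q.+2`!%:R)%:E) =
    EFin \o (fun n => series (exp_coeff `|x|%R) n.+2 - (1 + `|x|))%R.
  apply/funext => n /=; rewrite sumEFin; congr EFin.
  rewrite /series /= big_nat_recl// big_nat_recl//.
  rewrite /exp_coeff/= expr0 expr1 fact0 !divr1.
  by ring.
apply: cvg_EFin; first by near=> n.
rewrite /expR_rem2 -addrA -opprD; apply: cvgB; last exact: cvg_cst.
have : series (exp_coeff `|x|%R) n @[n --> \oo] --> expR `|x|%R.
  exact: is_cvg_series_exp_coeff.
rewrite -(cvg_shiftn 2).
rewrite (_ : (fun n => _) = (fun n => series (exp_coeff `|x|%R) n.+2))//.
by apply/funext => n; rewrite /= addn2.
Unshelve. all: by end_near. Qed.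

End exponential_bounds.

(** * Moment generating functions of sub-exponential variables *)

Section mgf.
Context {d : measure_display} {Omega : measurableType d} {R : realType}
  (P : probability Omega R).
Implicit Types Y h : Omega -> R.

Lemma integrableE_fin Y : P.-integrable setT (EFin \o Y) ->
  'E_P[Y] = (fine 'E_P[Y])%:E.
Proof.
by move=> iY; rewrite fineK// expectationE; exact: integrable_fin_num.
Qed.

Lemma mgf_le Y h (b : R) :
  P.-integrable setT (EFin \o Y) -> measurable_fun setT h ->
  (forall w, 0 <= h w)%R -> 'E_P[h] <= b%:E ->
  (forall w, expR (Y w) <= 1 + Y w + h w)%R ->
  'E_P[fun w => expR (Y w)] <= (expR (fine 'E_P[Y] + b))%:E.
Proof.
move=> iY mh h0 hb Yh.
have mY : measurable_fun setT Y by apply/measurable_EFinP; exact: measurable_int iY.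
have ih : P.-integrable setT (EFin \o h).
  apply/integrableP; split; first exact/measurable_EFinP.
  under eq_integral do rewrite /= ger0_norm//.
  by rewrite -expectationE (le_lt_trans hb)// ltry.
have i1 : P.-integrable setT (EFin \o cst 1%R).
  exact: finite_measure_integrable_cst.
apply: le_trans (_ : 'E_P[fun w => 1 + Y w + h w]%R <= _).
  apply: le_expectation_measurable => //.
  - exact: measurableT_comp.
  - by apply: measurable_funD => //; exact: measurable_funD.
rewrite expectationE.
under eq_integral do rewrite !EFinD.
have i1Y : P.-integrable setT (fun w => 1 + (Y w)%:E) by exact: integrableD.
rewrite integralD// integralD// integral_cst//= probability_setT mule1.
rewrite -!expectationE (integrableE_fin iY) -EFinD.
apply: le_trans (_ : (1 + fine 'E_P[Y])%:E + b%:E <= _); first by rewrite leeD2l.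
rewrite -EFinD lee_fin -addrA; exact: expR_ge1Dx.
Qed.

Lemma expectationZ_ge0 Y (c : R) : (0 <= c)%R -> measurable_fun setT Y ->
  (forall w, 0 <= Y w)%R -> 'E_P[fun w => c * Y w]%R = c%:E * 'E_P[Y].
Proof.
move=> c0 mY Y0; rewrite !expectationE -ge0_integralZl_EFin//.
- by move=> w _; rewrite lee_fin.
- exact/measurable_EFinP.
Qed.

(** Integrating [1 + |Y|/L <= expR (|Y|/L)] leaves [E|Y| / L <= 2 - 1]. *)
Lemma psi1_integrable Y (L : R) : (0 < L)%R -> measurable_fun setT Y ->
  'E_P[fun w => expR (`|Y w| / L)]%R <= 2%:E ->
  P.-integrable setT (EFin \o Y) /\ 'E_P[fun w => `|Y w|%R] <= L%:E.
Proof.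
move=> L0 mY EY.
have mE : measurable_fun setT (fun w => expR (`|Y w| / L))%R.
  apply: measurableT_comp => //; apply: measurable_funM => //.
  exact: measurableT_comp.
have EYL : 'E_P[fun w => `|Y w|%R] <= L%:E.
  suff : 'E_P[fun w => (1 + L^-1 * `|Y w|)%R] <= 2%:E.
    rewrite expectationE; under eq_integral do rewrite EFinD.
    rewrite ge0_integralD//; last 2 first.
    - by move=> w _; rewrite lee_fin mulr_ge0// invr_ge0 ltW.
    - apply/measurable_EFinP/measurable_funM => //; exact: measurableT_comp.
    rewrite integral_cst//= probability_setT mule1 -expectationE.
    rewrite expectationZ_ge0 ?invr_ge0 ?(ltW L0)//; last exact: measurableT_comp.
    rewrite addeC -leeBrDr// -EFinB (_ : (2 - 1 = 1 :> R)%R); last by ring.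
    by rewrite muleC lee_pdivrMr// mul1e.
  apply: le_trans EY; apply: le_expectation_measurable => //.
  - apply: measurable_funD => //; apply: measurable_funM => //.
    exact: measurableT_comp.
  - by move=> w; rewrite addr_ge0// mulr_ge0// invr_ge0 ltW.
  - by move=> w; rewrite mulrC; exact: expR_ge1Dx.
split => //; apply/integrableP; split; first exact/measurable_EFinP.
by move: EYL; rewrite expectationE => /le_lt_trans; apply; exact: ltry.
Qed.

(** [expR_le_psi1] is applied to [Y / L] with parameter [l * L]; centring removes the linear term,
    and 16 is 8 times the bound 2 on the exponential moment. *)
Lemma psi1_mgf Y (L l : R) : (0 < L)%R -> measurable_fun setT Y ->
  'E_P[fun w => expR (`|Y w| / L)]%R <= 2%:E -> (`|l| <= (2 * L)^-1)%R ->
  'E_P[fun w => expR (l * (Y w - fine 'E_P[Y]))]%R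
    <= (expR (16 * L ^+ 2 * l ^+ 2))%:E.
Proof.
move=> L0 mY EY lL; have [iY _] := psi1_integrable L0 mY EY.
have mE : measurable_fun setT (fun w => expR (`|Y w| / L))%R.
  apply: measurableT_comp => //; apply: measurable_funM => //.
  exact: measurableT_comp.
have c0 : (0 <= 8 * (l * L) ^+ 2)%R by rewrite mulr_ge0// sqr_ge0.
have ilY : P.-integrable setT (EFin \o (fun w => l * Y w)%R).
  have := integrableZl measurableT l iY.
  by congr (_.-integrable _ _); apply/funext => w.
have := @mgf_le (fun w => l * Y w)%R
  (fun w => 8 * (l * L) ^+ 2 * expR (`|Y w| / L))%R (16 * L ^+ 2 * l ^+ 2)%R ilY.
have -> : fine 'E_P[fun w => l * Y w]%R = (l * fine 'E_P[Y])%R.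
  rewrite expectationE; under eq_integral do rewrite EFinM.
  by rewrite integralZl// -expectationE (integrableE_fin iY).
move=> H.
have {H} : 'E_P[fun w => expR (l * Y w)]%R <=
    (expR (l * fine 'E_P[Y] + 16 * L ^+ 2 * l ^+ 2))%:E.
  apply: H.
  - exact: measurable_funM.
  - by move=> w; rewrite mulr_ge0// expR_ge0.
  - rewrite expectationZ_ge0//.
    apply: le_trans (_ : (8 * (l * L) ^+ 2)%:E * 2%:E <= _).
      by rewrite lee_wpmul2l.
    by rewrite -EFinM lee_fin exprMn; lra.
  - move=> w.
    have lL2 : (`|l * L| <= 2^-1)%R.
      by rewrite normrM (gtr0_norm L0) -ler_pdivlMr// -invfM.
    have := @expR_le_psi1 R (Y w / L)%R (l * L)%R lL2.
    rewrite normrM normfV (gtr0_norm L0).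
    by have -> : (l * L * (Y w / L) = l * Y w)%R by field; rewrite lt0r_neq0.
move=> H.
have -> : (fun w => expR (l * (Y w - fine 'E_P[Y])))%R =
    (fun w => expR (- (l * fine 'E_P[Y])) * expR (l * Y w))%R.
  by apply/funext => w; rewrite -expRD; congr expR; ring.
rewrite expectationZ_ge0 ?expR_ge0//; last first.
  by apply: measurableT_comp => //; exact: measurable_funM.
apply: le_trans (lee_wpmul2l _ H) _; first by rewrite lee_fin expR_ge0.
by rewrite -EFinM -expRD lee_fin addKr.
Qed.

End mgf.

(** * Bernstein's inequality for sub-exponential variables and under moment conditions *)

Section bernstein.
Context {d d' : measure_display} {Omega : measurableType d}
  {Theta : measurableType d'} {R : realType} (P : probability Omega R).
Context (m : nat) (X : 'I_m -> {RV P >-> Theta}) (indepX : independent_RVs X).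
Hypothesis m0 : (0 < m)%N.

Lemma bernstein_psi1 (V : 'I_m -> Theta -> R) (L t : R) :
  (0 < L)%R -> (0 < t)%R ->
  (forall i, measurable_fun setT (V i)) ->
  (forall i, 'E_P[fun w => expR (`|V i (X i w)| / L)]%R <= 2%:E) ->
  P [set w | 8 * L * Num.sqrt (m%:R * t) + 4 * L * t <=
     `|\sum_i (V i (X i w) - fine 'E_P[fun w => V i (X i w)])|]%R
    <= (2 * expR (- t))%:E.
Proof.
move=> L0 t0 mV EV.
have L0' : (0 <= L)%R by exact: ltW.
have v0 : (0 < 16 * L ^+ 2 * m%:R)%R by rewrite !mulr_gt0 ?exprn_gt0 ?ltr0n.
have l0 : (0 < (2 * L)^-1)%R by rewrite invr_gt0 mulr_gt0.
have := @bernstein_mgf _ _ _ _ _ P m X indepX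
  (fun i x => V i x - fine 'E_P[fun w => V i (X i w)])%R _ _ _ v0 l0 t0.
have -> : (2 * Num.sqrt (16 * L ^+ 2 * m%:R * t) + 2 * t / (2 * L)^-1 =
    8 * L * Num.sqrt (m%:R * t) + 4 * L * t)%R.
  rewrite invrK -(mulrA (16 * L ^+ 2)%R) sqrtrM ?mulr_ge0 ?sqr_ge0//.
  have -> : (16 * L ^+ 2 = (4 * L) ^+ 2)%R by ring.
  by rewrite sqrtr_sqr ger0_norm ?mulr_ge0//; ring.
apply.
- by move=> i; exact: measurable_funB.
- move=> l lL; exists (fun=> 16 * L ^+ 2 * l ^+ 2)%R.
  + by move=> i; apply: psi1_mgf => //; exact: measurableT_comp.
  + by rewrite sumr_const card_ord -mulr_natr; lra.
Qed.

Lemma nneseries_half (c : R) : \sum_(q <oo) (c * (1 / 2) ^+ q)%:E = (2 * c)%:E.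
Proof.
apply/cvg_lim => //.
have -> : (fun n => \sum_(0 <= q < n) (c * (1 / 2) ^+ q)%:E) =
    EFin \o series (geometric c (1 / 2))%R.
  by apply/funext => n /=; rewrite sumEFin.
apply: cvg_EFin; first by near=> n.
have -> : (2 * c = c * (1 - 1 / 2)^-1)%R by field.
by apply: cvg_geometric_series; rewrite ger0_norm//; lra.
Unshelve. all: by end_near. Qed.

(** In the series of the second-order remainder the factorials cancel those of the moment condition,
    and what remains is geometric with ratio [|l| * K <= 1/2]. The exponents are the expected
    remainders themselves, of which only the sum over [i] is controlled. *)
Lemma bernstein_moment (W : 'I_m -> Theta -> R) (sigma K t : R) :
  (0 < sigma)%R -> (0 < K)%R -> (0 < t)%R ->
  (forall i, measurable_fun setT (W i)) ->
  (forall i, P.-integrable setT (fun w => (W i (X i w))%:E)) ->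
  (forall i, 'E_P[fun w => W i (X i w)] = 0) ->
  (forall q, (2 <= q)%N ->
    \sum_i 'E_P[fun w => (`|W i (X i w)| ^+ q)%R] <=
    (m%:R * (q`!%:R / 2 * sigma ^+ 2 * K ^+ (q - 2)))%:E) ->
  P [set w | 2 * sigma * Num.sqrt (m%:R * t) + 4 * K * t <=
     `|\sum_i W i (X i w)|]%R <= (2 * expR (- t))%:E.
Proof.
move=> s0 K0 t0 mW iW EW0 EWq.
have v0 : (0 < sigma ^+ 2 * m%:R)%R by rewrite !mulr_gt0 ?exprn_gt0 ?ltr0n.
have l0 : (0 < (2 * K)^-1)%R by rewrite invr_gt0 mulr_gt0.
have := @bernstein_mgf _ _ _ _ _ P m X indepX W _ _ _ v0 l0 t0 mW.
have -> : (2 * Num.sqrt (sigma ^+ 2 * m%:R * t) + 2 * t / (2 * K)^-1 =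
    2 * sigma * Num.sqrt (m%:R * t) + 4 * K * t)%R.
  rewrite invrK -(mulrA (sigma ^+ 2)%R) sqrtrM ?sqr_ge0//.
  by rewrite sqrtr_sqr gtr0_norm//; ring.
apply=> l lL.
have mWX i : measurable_fun setT (fun w => W i (X i w)) by exact: measurableT_comp.
have mWq i q : measurable_fun setT (fun w => `|W i (X i w)| ^+ q)%R.
  by apply: measurable_funX; exact: measurableT_comp.
pose h i w := expR_rem2 (l * W i (X i w))%R.
have hE i : 'E_P[h i] = \sum_(q <oo)
    (`|l| ^+ q.+2 / q.+2`!%:R)%:E * 'E_P[fun w => (`|W i (X i w)| ^+ q.+2)%R].
  rewrite expectationE; under eq_integral do rewrite expR_rem2_series.
  rewrite integral_nneseries//.
    apply: eq_eseriesr => q _; rewrite -expectationZ_ge0//.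
    rewrite expectationE; apply: eq_integral => w _; congr EFin.
    by rewrite normrM exprMn mulrAC.
  move=> q; apply/measurable_EFinP/measurable_funM => //.
  apply: measurable_funX; apply: measurableT_comp => //.
    exact: measurable_funM.
have sum_h : \sum_i 'E_P[h i] <= (sigma ^+ 2 * m%:R * l ^+ 2)%:E.
  under eq_bigr do rewrite hE.
  have E0 i q : 0 <= (`|l| ^+ q.+2 / q.+2`!%:R)%:E *
      'E_P[fun w => (`|W i (X i w)| ^+ q.+2)%R].
    by apply: mule_ge0 => //; apply: expectation_ge0 => w; exact: exprn_ge0.
  rewrite -nneseries_sum//.
  apply: le_trans (_ : \sum_(q <oo)
      (sigma ^+ 2 * m%:R * l ^+ 2 / 2 * (1 / 2) ^+ q)%:E <= _); last first.
    by rewrite nneseries_half lee_fin; lra.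
  apply: lee_nneseries => [q _ _|q _]; first by apply: sume_ge0 => i _; exact: E0.
  rewrite -ge0_sume_distrr; last first.
    by move=> i _; apply: expectation_ge0 => w; exact: exprn_ge0.
  apply: le_trans (lee_wpmul2l _ (EWq q.+2 _)) _ => //.
  rewrite -EFinM lee_fin subn2/=.
  have -> : (`|l| ^+ q.+2 / (q.+2)`!%:R *
    (m%:R * ((q.+2)`!%:R / 2 * sigma ^+ 2 * K ^+ q)) =
    sigma ^+ 2 * m%:R * l ^+ 2 / 2 * (`|l| * K) ^+ q)%R.
    have f0 : (q.+2`!%:R != 0 :> R)%R by rewrite pnatr_eq0 -lt0n fact_gt0.
    rewrite -[(l ^+ 2)%R]ger0_norm ?sqr_ge0// normrX !exprS expr0 exprMn.
    by field.
  apply: ler_wpM2l.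
    by rewrite divr_ge0// mulr_ge0 ?sqr_ge0// mulr_ge0 ?sqr_ge0.
  apply: lerXn2r; rewrite ?nnegrE ?mulr_ge0 ?(ltW K0)//.
  by move: lL; rewrite invfM div1r -ler_pdivlMr.
have h0 i : 0 <= 'E_P[h i].
  by apply: expectation_ge0 => w; exact: expR_rem2_ge0.
(* Each expected remainder is finite because it is one of the nonnegative terms of a bounded sum. *)
have hfin i : 'E_P[h i] \is a fin_num.
  rewrite ge0_fin_numE//; apply: le_lt_trans (ltry (sigma ^+ 2 * m%:R * l ^+ 2)).
  apply: le_trans sum_h; rewrite (bigD1 i)//= leeDl//.
  by apply: sume_ge0 => j _.
exists (fun i => fine 'E_P[h i]); last first.
  rewrite -lee_fin -sumEFin.
  by under eq_bigr do rewrite fineK//.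
move=> i.
have ilW : P.-integrable setT (EFin \o (fun w => l * W i (X i w))%R).
  have := integrableZl measurableT l (iW i).
  by congr (_.-integrable _ _); apply/funext => w.
have := @mgf_le _ _ _ P (fun w => l * W i (X i w))%R (h i) (fine 'E_P[h i]) ilW.
have -> : fine 'E_P[fun w => l * W i (X i w)]%R = 0%R.
  rewrite expectationE; under eq_integral do rewrite EFinM.
  by rewrite integralZl// -expectationE EW0 mule0.
rewrite add0r; apply.
- apply: measurable_funB; first apply: measurable_funB => //.
  + apply: measurableT_comp => //; apply: measurableT_comp => //.
    exact: measurable_funM.
  + by apply: measurableT_comp => //; exact: measurable_funM.
- by move=> w; exact: expR_rem2_ge0.
- by rewrite fineK.
- by move=> w; exact: expR_le_rem2.
Qed.

End bernstein.

(** * The psi_2-norm *)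

Section psi2.
Context {d : measure_display} {Omega : measurableType d} {R : realType}
  (P : probability Omega R).
Implicit Types A B C Y Z W : Omega -> R.

(** Convexity of the exponential: the condition that the exponential moment is at most 2 survives
    averaging of exponents. *)
Lemma expectation_exp_average A B C :
  measurable_fun setT A -> measurable_fun setT B -> measurable_fun setT C ->
  (forall w, C w <= (A w + B w) / 2)%R ->
  'E_P[fun w => expR (A w)] <= 2%:E -> 'E_P[fun w => expR (B w)] <= 2%:E ->
  'E_P[fun w => expR (C w)] <= 2%:E.
Proof.
move=> mA mB mC CAB EA EB.
have mE Y : measurable_fun setT Y -> measurable_fun setT (expR \o Y).
  by move=> mY; exact: measurableT_comp.
apply: le_trans (_ : 'E_P[fun w => 2^-1 * (expR (A w) + expR (B w))]%R <= _).
  apply: le_expectation_measurable => //.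
  - exact: mE.
  - by apply: measurable_funM => //; apply: measurable_funD; exact: mE.
  - move=> w; apply: le_trans (_ : expR ((A w + B w) / 2) <= _)%R.
      by rewrite ler_expR.
    (* Written as squares of half exponents, the convexity inequality is the arithmetic-geometric
       one. *)
    have -> : (expR (A w) = expR (A w / 2) ^+ 2)%R.
      by rewrite -expRM_natl; congr expR; field.
    have -> : (expR (B w) = expR (B w / 2) ^+ 2)%R.
      by rewrite -expRM_natl; congr expR; field.
    rewrite mulrDl expRD.
    have := sqr_ge0 (expR (A w / 2) - expR (B w / 2))%R; lra.
rewrite expectationZ_ge0//; first last.
  by apply: measurable_funD; exact: mE.
have -> : 'E_P[fun w => expR (A w) + expR (B w)]%R =
    'E_P[fun w => expR (A w)] + 'E_P[fun w => expR (B w)].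
  by rewrite !expectationE -ge0_integralD//; apply/measurable_EFinP; exact: mE.
apply: le_trans (_ : (2^-1)%:E * (2%:E + 2%:E) <= _).
  by rewrite lee_wpmul2l// leeD.
by rewrite -EFinD -EFinM lee_fin; lra.
Qed.

Lemma measurable_sqr_div Y (a : R) : measurable_fun setT Y ->
  measurable_fun setT (fun w => Y w ^+ 2 / a ^+ 2)%R.
Proof. by move=> mY; apply: measurable_funM => //; exact: measurable_funX. Qed.

Lemma psi2_norm_ge0 Y : 0 <= psi2_norm P Y.
Proof.
by apply: le_ereal_inf_tmp => _ [a [a0 _] <-]; rewrite lee_fin ltW.
Qed.

(** A strict inequality provides an admissible [b < a] without the infimum having to be attained.
    This is why the scales chosen later lie strictly above the norms they replace. *)
Lemma psi2_norm_exp Y (a : R) : measurable_fun setT Y ->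
  psi2_norm P Y < a%:E -> 'E_P[fun w => expR (Y w ^+ 2 / a ^+ 2)]%R <= 2%:E.
Proof.
move=> mY /ereal_inf_lt[_ [b [b0 Eb] <-]]; rewrite lte_fin => ba.
apply: le_trans (_ : 'E_P[fun w => expR (`|Y w| ^+ 2 / b ^+ 2)]%R <= _).
  apply: le_expectation_measurable => //.
  - by apply: measurableT_comp => //; exact: measurable_sqr_div.
  - apply: measurableT_comp => //; apply: measurable_sqr_div.
    exact: measurableT_comp.
  - move=> w; rewrite ler_expR real_normK ?num_real// ler_wpM2l ?sqr_ge0//.
    rewrite lef_pV2 ?posrE ?exprn_gt0// ?(lt_trans b0)//.
    by rewrite lerXn2r ?nnegrE ?ltW// (lt_trans b0).
by move: Eb; rewrite leeBlDr.
Qed.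

Lemma psi2_norm_le Y (a : R) : (0 < a)%R ->
  'E_P[fun w => expR (Y w ^+ 2 / a ^+ 2)]%R <= 2%:E -> psi2_norm P Y <= a%:E.
Proof.
move=> a0 Ea; apply: ereal_inf_lbound; exists a => //; split => //.
rewrite leeBlDr//; apply: le_trans Ea.
rewrite le_eqVlt; apply/orP; left; apply/eqP; congr expectation.
by apply/funext => w; rewrite real_normK ?num_real.
Qed.

(** A quasi-triangle inequality: since [(y + z)^2 <= 2 y^2 + 2 z^2], at scale [2 * (a + b)] the
    exponent of [W] is at most the average of those of [Y] at scale [a] and [Z] at scale [b]. *)
Lemma psi2_norm_le_add Y Z W :
  measurable_fun setT Y -> measurable_fun setT Z -> measurable_fun setT W ->
  (forall w, `|W w| <= `|Y w| + `|Z w|)%R ->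
  psi2_norm P W <= 2%:E * (psi2_norm P Y + psi2_norm P Z).
Proof.
move=> mY mZ mW WYZ.
have [Yoo|] := ltP (psi2_norm P Y) +oo; last first.
  rewrite leye_eq => /eqP ->; rewrite addye ?gt0_muley ?leey ?lte_fin//.
  by rewrite gt_eqF// (lt_le_trans _ (psi2_norm_ge0 Z)).
have [Zoo|] := ltP (psi2_norm P Z) +oo; last first.
  rewrite leye_eq => /eqP ->; rewrite addey ?gt0_muley ?leey ?lte_fin//.
  by rewrite gt_eqF// (lt_le_trans _ (psi2_norm_ge0 Y)).
have yE : psi2_norm P Y = (fine (psi2_norm P Y))%:E.
  by rewrite fineK// ge0_fin_numE// psi2_norm_ge0.
have zE : psi2_norm P Z = (fine (psi2_norm P Z))%:E.
  by rewrite fineK// ge0_fin_numE// psi2_norm_ge0.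
have y0 : (0 <= fine (psi2_norm P Y))%R by rewrite fine_ge0// psi2_norm_ge0.
have z0 : (0 <= fine (psi2_norm P Z))%R by rewrite fine_ge0// psi2_norm_ge0.
apply/lee_addgt0Pr => e e0; rewrite yE zE.
set y := fine _ in yE y0 *; set z := fine _ in zE z0 *.
(* The slack [e / 4] on each norm becomes [e] after adding the two and doubling. *)
have a0 : (0 < y + e / 4)%R by rewrite ltr_wpDl// divr_gt0.
have b0 : (0 < z + e / 4)%R by rewrite ltr_wpDl// divr_gt0.
have Ya : psi2_norm P Y < (y + e / 4)%:E by rewrite yE lte_fin ltrDl divr_gt0.
have Zb : psi2_norm P Z < (z + e / 4)%:E by rewrite zE lte_fin ltrDl divr_gt0.
have -> : 2%:E * (y%:E + z%:E) + e%:E = (2 * ((y + e / 4) + (z + e / 4)))%:E.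
  by congr EFin; field.
move: (y + e / 4)%R (z + e / 4)%R a0 b0 Ya Zb => a b a0 b0 Ya Zb.
apply: psi2_norm_le; first by rewrite mulr_gt0 ?addr_gt0.
apply: (expectation_exp_average _ _ _ _ (psi2_norm_exp mY Ya)
  (psi2_norm_exp mZ Zb)); try exact: measurable_sqr_div.
move=> w; have := WYZ w.
rewrite -[(Y w ^+ 2)%R]real_normK ?num_real// -[(Z w ^+ 2)%R]real_normK ?num_real//.
rewrite -[(W w ^+ 2)%R]real_normK ?num_real//.
move: `|Y w|%R `|Z w|%R `|W w|%R (normr_ge0 (Y w)) (normr_ge0 (Z w)) (normr_ge0 (W w)).
move=> y' z' w' y'0 z'0 w'0 h.
apply: le_trans (_ : ((2 * y' ^+ 2 + 2 * z' ^+ 2) / (2 * (a + b)) ^+ 2 <= _)%R).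
  rewrite ler_wpM2r ?invr_ge0 ?sqr_ge0//.
  have := sqr_ge0 (y' - z')%R; nra.
have le1 (u c : R) : (0 < c)%R -> (c <= a + b)%R ->
    (2 * u ^+ 2 / (2 * (a + b)) ^+ 2 <= u ^+ 2 / c ^+ 2 / 2)%R.
  move=> c0 cab.
  have -> : (2 * u ^+ 2 / (2 * (a + b)) ^+ 2 = u ^+ 2 / (a + b) ^+ 2 / 2)%R.
    by field; rewrite lt0r_neq0// addr_gt0.
  rewrite ler_wpM2r// ler_wpM2l ?sqr_ge0// lef_pV2 ?posrE ?exprn_gt0// ?addr_gt0//.
  by rewrite lerXn2r// nnegrE ltW// addr_gt0.
rewrite mulrDl [leRHS]mulrDl; apply: lerD.
- by apply: le1 => //; rewrite lerDl ltW.
- by apply: le1 => //; rewrite lerDr ltW.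
Qed.

End psi2.

(** * Tails of the centred sums of squares and of their increments *)

Section square_process.
Context {d d' : measure_display} {Omega : measurableType d}
  {Theta : measurableType d'} {R : realType} (P : probability Omega R).
Context (m : nat) (X : 'I_m -> {RV P >-> Theta}) (indepX : independent_RVs X).
Hypothesis m0 : (0 < m)%N.
Implicit Types f g h : Theta -> R.

Definition square_sum f (w : Omega) : R :=
  (\sum_i (f (X i w) ^+ 2 - second_moment X f i))%R.

Lemma measurable_square_sum f : measurable_fun setT f ->
  measurable_fun setT (square_sum f).
Proof.
move=> mf; apply: (@measurable_sum_RV _ _ _ _ _ _ _ X
  (fun i x => f x ^+ 2 - second_moment X f i)%R) => i.
by apply: measurable_funB => //; exact: measurable_funX.
Qed.

Lemma sq_deviationE f w : sq_deviation X f w = (`|square_sum f w| / m%:R)%R.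
Proof. by rewrite /sq_deviation normrM ger0_norm ?invr_ge0// mulrC. Qed.

Section second_moments.
Variables (f : Theta -> R) (rho : R) (i : 'I_m).
Hypotheses (mf : measurable_fun setT f) (rho0 : (0 < rho)%R).
Hypothesis f_rho : 'E_P[fun w => expR (f (X i w) ^+ 2 / rho ^+ 2)]%R <= 2%:E.

(** The psi_2 condition on [f (X i)] at scale [rho] is the psi_1 condition on its square at scale
    [rho ^+ 2]. *)
Lemma psi2_sqr_integrable :
  P.-integrable setT (EFin \o (fun w => f (X i w) ^+ 2)%R) /\
  'E_P[fun w => `|f (X i w) ^+ 2|%R] <= (rho ^+ 2)%:E.
Proof.
apply: psi1_integrable; first by rewrite exprn_gt0.
  by apply: measurable_funX; exact: measurableT_comp.
apply: le_trans f_rho; rewrite le_eqVlt; apply/orP; left; apply/eqP.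
by congr expectation; apply/funext => w; rewrite ger0_norm ?sqr_ge0.
Qed.

(** The expectation is finite, so the [fine] in [second_moment] loses nothing. *)
Lemma second_momentE : 'E_P[fun w => f (X i w) ^+ 2]%R = (second_moment X f i)%:E.
Proof. by apply: integrableE_fin; exact: psi2_sqr_integrable.1. Qed.

Lemma second_moment_le : (second_moment X f i <= rho ^+ 2)%R.
Proof.
rewrite -lee_fin -second_momentE; apply: le_trans psi2_sqr_integrable.2.
rewrite le_eqVlt; apply/orP; left; apply/eqP.
by congr expectation; apply/funext => w; rewrite ger0_norm ?sqr_ge0.
Qed.

End second_moments.

Section increments.
Variables (g h : Theta -> R) (rho D : R).
Hypotheses (mg : measurable_fun setT g) (mh : measurable_fun setT h).
Hypotheses (rho0 : (0 < rho)%R) (D0 : (0 < D)%R).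
Hypothesis g_rho : forall i,
  'E_P[fun w => expR (g (X i w) ^+ 2 / rho ^+ 2)]%R <= 2%:E.
Hypothesis h_rho : forall i,
  'E_P[fun w => expR (h (X i w) ^+ 2 / rho ^+ 2)]%R <= 2%:E.
Hypothesis gh_D : forall i,
  'E_P[fun w => expR ((g (X i w) - h (X i w)) ^+ 2 / D ^+ 2)]%R <= 2%:E.

Let mX (f : Theta -> R) i : measurable_fun setT f ->
  measurable_fun setT (fun w => f (X i w)).
Proof. by move=> mf; exact: measurableT_comp. Qed.

(** Factor [g^2 - h^2 = (g - h)(g + h)] and apply [2 x y <= x^2 + y^2] to [|g - h| / D] and
    [|g + h| / (2 rho)]. The square of the latter is at most the average of [g^2 / rho^2] and
    [h^2 / rho^2], so averaging exponents twice suffices. *)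
Lemma psi1_sqr_sub i :
  'E_P[fun w => expR (`|g (X i w) ^+ 2 - h (X i w) ^+ 2| / (2 * rho * D))]%R
    <= 2%:E.
Proof.
have mgi := mX i mg; have mhi := mX i mh.
have mg2 := measurable_sqr_div rho mgi; have mh2 := measurable_sqr_div rho mhi.
apply: (@expectation_exp_average _ _ _ _
  (fun w => (g (X i w) - h (X i w)) ^+ 2 / D ^+ 2)%R
  (fun w => (g (X i w) ^+ 2 / rho ^+ 2 + h (X i w) ^+ 2 / rho ^+ 2) / 2)%R) => //.
- by apply: (measurable_sqr_div D); exact: measurable_funB.
- by apply: measurable_funM => //; exact: measurable_funD.
- apply: measurable_funM => //; apply: measurableT_comp => //.
  by apply: measurable_funB; exact: measurable_funX.
- move=> w; move: (g (X i w)) (h (X i w)) => a b.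
  have -> : (a ^+ 2 - b ^+ 2 = (a - b) * (a + b))%R by ring.
  rewrite normrM.
  have -> : (`|a - b| * `|a + b| / (2 * rho * D) =
      2 * (`|a - b| / D) * (`|a + b| / (2 * rho)) / 2)%R.
    by field; rewrite !lt0r_neq0.
  rewrite ler_wpM2r//.
  apply: le_trans (_ : ((`|a - b| / D) ^+ 2 + (`|a + b| / (2 * rho)) ^+ 2 <= _)%R).
    have := sqr_ge0 (`|a - b| / D - `|a + b| / (2 * rho))%R; nra.
  rewrite !expr_div_n !real_normK ?num_real// lerD2l.
  have -> : ((a ^+ 2 / rho ^+ 2 + b ^+ 2 / rho ^+ 2) / 2 =
    (2 * a ^+ 2 + 2 * b ^+ 2) / (2 * rho) ^+ 2)%R by field; rewrite lt0r_neq0.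
  rewrite ler_wpM2r ?invr_ge0 ?sqr_ge0//.
  have := sqr_ge0 (a - b)%R; nra.
- apply: (expectation_exp_average mg2 mh2) => //.
  by apply: measurable_funM => //; exact: measurable_funD.
Qed.

Let sqr_subE i : 'E_P[fun w => g (X i w) ^+ 2 - h (X i w) ^+ 2]%R =
  (second_moment X g i - second_moment X h i)%:E.
Proof.
have [ig _] := psi2_sqr_integrable mg rho0 (g_rho i).
have [ih _] := psi2_sqr_integrable mh rho0 (h_rho i).
rewrite expectationE; under eq_integral do rewrite EFinB.
rewrite integralB// -!expectationE.
by rewrite (second_momentE mg rho0)// (second_momentE mh rho0).
Qed.

Lemma second_moment_sub_le i :
  (`|second_moment X g i - second_moment X h i| <= 2 * rho * D)%R.
Proof.
have mgi := mX i mg; have mhi := mX i mh.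
have mgh : measurable_fun setT (fun w => g (X i w) ^+ 2 - h (X i w) ^+ 2)%R.
  by apply: measurable_funB; exact: measurable_funX.
have L0 : (0 < 2 * rho * D)%R by rewrite !mulr_gt0.
have [_] := psi1_integrable L0 mgh (psi1_sqr_sub i).
rewrite -lee_fin; apply: le_trans.
have -> : (`|second_moment X g i - second_moment X h i|)%:E =
  `|'E_P[fun w => g (X i w) ^+ 2 - h (X i w) ^+ 2]%R| by rewrite sqr_subE.
rewrite !expectationE; apply: le_abse_integral => //.
exact/measurable_EFinP.
Qed.

Lemma square_sum_sub_tail (t : R) : (0 < t)%R ->
  P [set w | 16 * rho * D * Num.sqrt (m%:R * t) + 8 * rho * D * t <=
     `|square_sum g w - square_sum h w|]%R <= (2 * expR (- t))%:E.
Proof.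
move=> t0; have L0 : (0 < 2 * rho * D)%R by rewrite !mulr_gt0.
have := @bernstein_psi1 _ _ _ _ _ P m X indepX m0
  (fun i x => g x ^+ 2 - h x ^+ 2)%R _ t L0 t0 _ psi1_sqr_sub.
have -> : (8 * (2 * rho * D) * Num.sqrt (m%:R * t) + 4 * (2 * rho * D) * t =
  16 * rho * D * Num.sqrt (m%:R * t) + 8 * rho * D * t)%R by ring.
move=> H; apply: le_trans (H _); last first.
  by move=> i; apply: measurable_funB; exact: measurable_funX.
have subE w : (square_sum g w - square_sum h w = \sum_i
    (g (X i w) ^+ 2 - h (X i w) ^+ 2 -
     fine 'E_P[fun w => g (X i w) ^+ 2 - h (X i w) ^+ 2]))%R.
  rewrite /square_sum -sumrB; apply: eq_bigr => i _.
  by rewrite sqr_subE /=; ring.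
by under eq_set do rewrite subE.
Qed.

End increments.

(** The estimate for the starting points of the chains, and the one place where [sigma] and [K]
    enter a tail bound. *)
Lemma square_sum_tail0 f (rho sigma K t : R) :
  measurable_fun setT f ->
  (0 < rho)%R -> (0 < sigma)%R -> (0 < K)%R -> (0 < t)%R ->
  (forall i, 'E_P[fun w => expR (f (X i w) ^+ 2 / rho ^+ 2)]%R <= 2%:E) ->
  (forall q : nat, (2 <= q)%N ->
    (m%:R^-1)%:E * \sum_(i < m)
       'E_P[fun w => (`|f (X i w) ^+ 2 - second_moment X f i| ^+ q)%R]
    <= (q`!%:R / 2 * sigma ^+ 2 * K ^+ (q - 2))%:E) ->
  P [set w | 2 * sigma * Num.sqrt (m%:R * t) + 4 * K * t <=
     `|square_sum f w|]%R <= (2 * expR (- t))%:E.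
Proof.
move=> mf rho0 s0 K0 t0 f_rho Hq.
have iW i : P.-integrable setT
    (fun w => (f (X i w) ^+ 2 - second_moment X f i)%:E).
  have [iY _] := psi2_sqr_integrable mf rho0 (f_rho i).
  under eq_fun do rewrite EFinB.
  by apply: integrableB => //; exact: finite_measure_integrable_cst.
apply: (@bernstein_moment _ _ _ _ _ P m X indepX m0
  (fun i x => f x ^+ 2 - second_moment X f i)%R) => //.
- by move=> i; apply: measurable_funB => //; exact: measurable_funX.
- move=> i; have [iY _] := psi2_sqr_integrable mf rho0 (f_rho i).
  rewrite expectationE; under eq_integral do rewrite EFinB.
  rewrite integralB//; last exact: finite_measure_integrable_cst.
  rewrite -expectationE (second_momentE mf rho0 (f_rho i)).
  by rewrite integral_cst//= probability_setT mule1 subee.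
- move=> q q2; have := Hq q q2.
  rewrite muleC -lee_pdivlMr ?invr_gt0 ?ltr0n// => /le_trans; apply.
  by rewrite -EFinM invrK lee_fin mulrC.
Qed.

End square_process.

(** * Chaining along one path, outside the exceptional event *)

Section deterministic_chaining.
Local Open Scope ring_scope.
Context {R : realType}.

(** Minkowski's inequality in squared form, from [2 x y <= (b/a) x^2 + (a/b) y^2]; with these
    weights the bounds recombine exactly into [(a + b) ^+ 2]. *)
Lemma sum_sqrD_le (I : finType) (x y : I -> R) (a b : R) : 0 < a -> 0 < b ->
  \sum_i x i ^+ 2 <= a ^+ 2 -> \sum_i y i ^+ 2 <= b ^+ 2 ->
  \sum_i (x i + y i) ^+ 2 <= (a + b) ^+ 2.
Proof.
move=> a0 b0 xa yb.
have h i : (x i + y i) ^+ 2 <= (1 + b / a) * x i ^+ 2 + (1 + a / b) * y i ^+ 2.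
  have : 0 <= (b * x i - a * y i) ^+ 2 / (a * b).
    by rewrite divr_ge0 ?sqr_ge0// mulr_ge0// ltW.
  have -> : (b * x i - a * y i) ^+ 2 / (a * b) =
      b / a * x i ^+ 2 + a / b * y i ^+ 2 - 2 * x i * y i.
    by field; rewrite !lt0r_neq0.
  lra.
apply: le_trans (ler_sum _ (fun i _ => h i)) _.
rewrite big_split/= -!mulr_sumr.
apply: le_trans (_ : (1 + b / a) * a ^+ 2 + (1 + a / b) * b ^+ 2 <= _).
  by apply: lerD; rewrite ler_wpM2l// addr_ge0// divr_ge0// ltW.
by rewrite le_eqVlt; apply/orP; left; apply/eqP; field; rewrite !lt0r_neq0.
Qed.

(** Minkowski's inequality applied link by link. The extra [b] keeps the accumulated radius positive
    while the sum of the [c n] is still empty. *)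
Lemma sum_sqr_telescope_le (I : finType) (a : nat -> I -> R) (c : nat -> R)
    (b : R) (p N : nat) : (p <= N)%N -> 0 < b ->
  (forall n, (p <= n < N)%N -> 0 < c n) ->
  (forall n, (p <= n < N)%N -> \sum_i (a n.+1 i - a n i) ^+ 2 <= c n ^+ 2) ->
  \sum_i (a N i - a p i) ^+ 2 <= (b + \sum_(p <= n < N) c n) ^+ 2.
Proof.
move=> pN b0; elim: N pN => [|N IH] pN c0 ac.
  move: pN; rewrite leqn0 => /eqP ->; rewrite big1 ?sqr_ge0// => i _.
  by rewrite subrr expr0n.
move: pN; rewrite leq_eqVlt => /predU1P[->|].
  by rewrite big1 ?sqr_ge0// => i _; rewrite subrr expr0n.
rewrite ltnS => pN; rewrite big_nat_recr//= addrA.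
have -> : \sum_i (a N.+1 i - a p i) ^+ 2 =
    \sum_i ((a N i - a p i) + (a N.+1 i - a N i)) ^+ 2.
  by apply: eq_bigr => i _; congr (_ ^+ 2); ring.
have cN n : (p <= n < N)%N -> (p <= n < N.+1)%N.
  by move=> /andP[-> /ltnW]; rewrite ltnS.
apply: sum_sqrD_le.
- rewrite ltr_wpDr//; rewrite big_nat; apply: sumr_ge0 => n /cN/c0; exact: ltW.
- by apply: c0; rewrite pN ltnSn.
- by apply: IH => // n /cN; [exact: c0|exact: ac].
- by apply: ac; rewrite pN ltnSn.
Qed.

(* Increments are linearised by Bernstein's inequality as long as [2 ^ n <= m];
   beyond the index [p] where this fails, [T N - T p] is controlled through the
   Euclidean norm of [a N - a p], and [sum (a p)^2] through [T p] itself, which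
   costs the factor [2] in front of [B]. *)
Lemma chaining_le (m l N : nat) (a s : nat -> 'I_m -> R) (q D e : nat -> R)
    (mu rho G B : R) :
  let T n := \sum_i (a n i ^+ 2 - s n i) in
  (l <= N)%N -> 0 < mu -> mu ^+ 2 = m%:R -> 0 < rho -> 0 < G ->
  (forall n, 0 < q n) -> (forall n, q n ^+ 2 = 2 ^+ n) ->
  (forall n, 0 < D n) ->
  \sum_(l <= n < N) q n * D n <= 4 * G ->
  (forall n, (l <= n <= N)%N -> 0 <= e n /\ q n * e n <= G) ->
  (forall n i, (l <= n <= N)%N -> s n i <= rho ^+ 2) ->
  (forall n i, (l <= n <= N)%N -> `|s N i - s n i| <= 2 * rho * e n) ->
  `|T l| <= B ->
  (forall n, (l <= n < N)%N -> (2 ^ n <= m)%N ->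
     `|T n.+1 - T n| <= 112 * rho * mu * (q n * D n)) ->
  (forall n, (l <= n < N)%N -> (m < 2 ^ n)%N ->
     \sum_i (a n.+1 i - a n i) ^+ 2 <= (3 * (q n * D n)) ^+ 2) ->
  `|T N| <= 2 * B + 1068 * (G ^+ 2 + rho * mu * G).
Proof.
move=> T lN mu0 mu2 rho0 G0 q0 q2 D0 sumD eG s_rho s_e TB small large.
(* [p] is the first level from [l] on with [m < 2 ^ p], or [N] if no earlier level qualifies. *)
have [p [/andP[lp pN] p_small p_large]] : exists p, [/\ (l <= p <= N)%N,
    forall n, (l <= n < p)%N -> (2 ^ n <= m)%N & (p < N)%N -> (m < 2 ^ p)%N].
  have exN : exists n, (l <= n)%N && ((n == N) || (m < 2 ^ n)%N).
    by exists N; rewrite lN eqxx.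
  case: (ex_minnP exN) => p /andP[lp pN] pmin; exists p; split.
  - by rewrite lp /=; apply: pmin; rewrite lN eqxx.
  - move=> n /andP[ln np]; rewrite leqNgt; apply/negP => mn.
    have : (p <= n)%N by apply: pmin; rewrite ln mn orbT.
    by rewrite leqNgt np.
  - by move=> pN'; move: pN; rewrite (ltn_eqF pN').
have qD0 n : 0 < q n * D n by rewrite mulr_gt0.
have sum_split : \sum_(l <= n < p) q n * D n + \sum_(p <= n < N) q n * D n <= 4 * G.
  by rewrite -big_cat_nat.
have sum1 : 0 <= \sum_(l <= n < p) q n * D n by apply: sumr_ge0 => n _; exact: ltW.
have sum2 : 0 <= \sum_(p <= n < N) q n * D n by apply: sumr_ge0 => n _; exact: ltW.
have Tp : `|T p| <= B + 448 * (rho * mu * G).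
  have -> : T p = T l + \sum_(l <= n < p) (T n.+1 - T n).
    by rewrite telescope_sumr// addrCA subrr addr0.
  apply: le_trans (ler_normD _ _) _; apply: lerD => //.
  apply: le_trans (ler_norm_sum _ _ _) _.
  apply: le_trans (_ : 112 * rho * mu * \sum_(l <= n < p) q n * D n <= _).
    rewrite mulr_sumr big_nat [leRHS]big_nat; apply: ler_sum => n lnp.
    apply: small; last exact: p_small.
    by move: lnp => /andP[-> /leq_trans]; apply.
  have : 0 < 112 * rho * mu by rewrite !mulr_gt0.
  have -> : 448 * (rho * mu * G) = 112 * rho * mu * (4 * G) by ring.
  by move=> /ltW c0; apply: ler_wpM2l => //; lra.
pose S := \sum_i (a N i - a p i) ^+ 2.
have S0 : 0 <= S by apply: sumr_ge0 => i _; exact: sqr_ge0.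
(* Here [b = G], and the links sum to at most [3 * (4 * G)]: the radius is [13 * G]. *)
have SG : S <= 169 * G ^+ 2.
  have := @sum_sqr_telescope_le 'I_m a (fun n => 3 * (q n * D n)) G p N pN G0.
  rewrite -mulr_sumr => H; apply: le_trans (H _ _) _.
  - by move=> n _; rewrite mulr_gt0.
  - move=> n /andP[pn nN]; apply: large; first by rewrite nN (leq_trans lp pn).
    apply: leq_trans (p_large (leq_ltn_trans pn nN)) _.
    by rewrite leq_exp2l.
  - have -> : 169 * G ^+ 2 = (13 * G) ^+ 2 by ring.
    rewrite ler_sqr ?nnegrE; lra.
have mr0 : 0 < mu * rho by rewrite mulr_gt0.
(* The weight in [2 |y (x - y)| <= k y^2 + (x - y)^2 / k]. This choice gives [k <= 1],
   [k * (mu * rho) ^+ 2 <= rho * mu * G] and [G ^+ 2 / k = rho * mu * G + G ^+ 2]. *)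
pose k := G / (mu * rho + G).
have den0 : 0 < mu * rho + G by rewrite addr_gt0.
have k0 : 0 < k by rewrite divr_gt0.
have k1 : k <= 1 by rewrite ler_pdivrMr// mul1r lerDr ltW.
have sq_p : \sum_i a p i ^+ 2 <= `|T p| + (mu * rho) ^+ 2.
  have -> : \sum_i a p i ^+ 2 = T p + \sum_i s p i.
    by rewrite /T sumrB subrK.
  apply: lerD; first exact: ler_norm.
  apply: le_trans (_ : \sum_(i < m) rho ^+ 2 <= _).
    by apply: ler_sum => i _; apply: s_rho; rewrite lp.
  by rewrite sumr_const card_ord -mulr_natl -mu2 exprMn.
have sq_sub : `|\sum_i (a N i ^+ 2 - a p i ^+ 2)| <=
    S + k * \sum_i a p i ^+ 2 + S / k.
  apply: le_trans (ler_norm_sum _ _ _) _.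
  rewrite /S mulr_sumr mulr_suml -!big_split/=; apply: ler_sum => i _.
  move: (a N i) (a p i) => x y.
  have -> : x ^+ 2 - y ^+ 2 = (x - y) ^+ 2 + 2 * (y * (x - y)) by ring.
  apply: le_trans (ler_normD _ _) _; rewrite (ger0_norm (sqr_ge0 _)) -addrA lerD2l.
  rewrite !normrM (ger0_norm (ler0n _ 2)) -[y ^+ 2]real_normK ?num_real//.
  rewrite -[X in X / k]real_normK ?num_real//.
  have : 0 <= (k * `|y| - `|x - y|) ^+ 2 / k by rewrite divr_ge0 ?sqr_ge0// ltW.
  have -> : (k * `|y| - `|x - y|) ^+ 2 / k =
      k * `|y| ^+ 2 + `|x - y| ^+ 2 / k - 2 * (`|y| * `|x - y|).
    by field; rewrite lt0r_neq0.
  by rewrite subr_ge0.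
(* If [p < N] then [m < 2 ^ p], so [mu <= q p]: one factor [mu] of [m = mu ^+ 2] is absorbed by
   [mu * e p <= q p * e p <= G]. *)
have mean_sub : `|\sum_i (s N i - s p i)| <= 2 * (rho * mu * G).
  move: pN; rewrite leq_eqVlt => /predU1P[->|pN].
    rewrite big1 ?normr0 ?mulr_ge0 ?(ltW G0) ?(ltW rho0) ?(ltW mu0)// => i _.
    by rewrite subrr.
  have lpN : (l <= p <= N)%N by rewrite lp ltnW.
  have [e0 qeG] := eG _ lpN.
  have mq : mu <= q p.
    rewrite -ler_sqr ?nnegrE ?(ltW mu0) ?(ltW (q0 p))// mu2 q2 -natrX ler_nat.
    exact/ltnW/p_large.
  apply: le_trans (ler_norm_sum _ _ _) _.
  apply: le_trans (_ : \sum_(i < m) 2 * rho * e p <= _).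
    by apply: ler_sum => i _; exact: s_e.
  rewrite sumr_const card_ord -[leLHS]mulr_natl -mu2.
  have : mu * e p <= G by apply: le_trans qeG; rewrite ler_wpM2r.
  move=> h; have -> : mu ^+ 2 * (2 * rho * e p) = 2 * (rho * mu * (mu * e p)) by ring.
  by rewrite ler_wpM2l// ler_wpM2l// mulr_ge0 ?(ltW rho0) ?(ltW mu0).
have kp : k * \sum_i a p i ^+ 2 <= `|T p| + rho * mu * G.
  apply: le_trans (ler_wpM2l (ltW k0) sq_p) _; rewrite mulrDr; apply: lerD.
    by rewrite ler_piMl.
  have -> : k * (mu * rho) ^+ 2 = rho * mu * G * (mu * rho / (mu * rho + G)).
    by rewrite /k; field; rewrite lt0r_neq0.
  rewrite ler_piMr ?mulr_ge0 ?(ltW G0) ?(ltW rho0) ?(ltW mu0)//.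
  by rewrite ler_pdivrMr// mul1r lerDl ltW.
have Sk : S / k <= 169 * (rho * mu * G + G ^+ 2).
  apply: le_trans (_ : 169 * G ^+ 2 / k <= _).
    by rewrite ler_wpM2r// invr_ge0 ltW.
  rewrite le_eqVlt; apply/orP; left; apply/eqP; rewrite /k; field.
  by rewrite !lt0r_neq0.
(* The bounds add up to [2 * |T p| + 338 * G ^+ 2 + 172 * (rho * mu * G)], and
   [2 * 448 + 172 = 1068]. *)
have -> : T N = T p + (\sum_i (a N i ^+ 2 - a p i ^+ 2) - \sum_i (s N i - s p i)).
  by rewrite /T !sumrB; ring.
apply: le_trans (ler_normD _ _) _.
apply: le_trans (lerD (lexx _) (ler_normB _ _)) _.
have r0 : 0 <= rho * mu * G by rewrite !mulr_ge0// ltW.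
have G2 := sqr_ge0 G.
lra.
Qed.

End deterministic_chaining.

(** * Arithmetic of the union bound *)

Section union_bound.
Context {R : realType}.
Local Open Scope ring_scope.

Lemma expR1_ge2 : 2 <= expR 1 :> R.
Proof. by have := @expR_ge1Dx R 1; lra. Qed.

Lemma expR_nat_ge (k : nat) : (2 ^ k)%:R <= expR k%:R :> R.
Proof.
rewrite natrX -[k%:R]mulr1 expRM_natl; apply: lerXn2r; rewrite ?nnegrE ?expR_ge0//.
exact: expR1_ge2.
Qed.

Lemma expR_pow2 (n : nat) : expR (- (5 * (2 ^ n)%:R)) <= 2^-1 :> R.
Proof.
apply: le_trans (_ : expR (- 1) <= _).
  rewrite ler_expR lerN2; have : (1 <= (2 ^ n)%:R :> R) by rewrite ler1n expn_gt0.
  lra.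
by rewrite expRN lef_pV2 ?posrE ?expR_gt0// expR1_ge2.
Qed.

(** With [x] the exponential at level [n], the next one is [x ^+ 2], and [2 x <= 4 x - 4 x^2]
    because [x <= 1/2]; the right-hand sides telescope. *)
Lemma sum_expR_pow2 (l N : nat) : (l <= N)%N ->
  \sum_(l <= n < N) 2 * expR (- (5 * (2 ^ n)%:R)) <=
  4 * expR (- (5 * (2 ^ l)%:R)) - 4 * expR (- (5 * (2 ^ N)%:R)) :> R.
Proof.
elim: N => [|N IH].
  by rewrite leqn0 => /eqP ->; rewrite big_geq// subrr.
rewrite leq_eqVlt => /predU1P[->|]; first by rewrite big_geq// subrr.
rewrite ltnS => lN; rewrite big_nat_recr//=.
have -> : expR (- (5 * (2 ^ N.+1)%:R)) = expR (- (5 * (2 ^ N)%:R)) ^+ 2 :> R.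
  by rewrite -expRM_natl; congr expR; rewrite expnS natrM; ring.
have := IH lN; have := expR_pow2 N; have := expR_gt0 (- (5 * (2 ^ N)%:R) : R).
nra.
Qed.

(** The cardinality at level [l] costs at most [expR (2 * u)], and the pairs at level [n] cost at
    most [expR (3 * 2^n)], out of exponents 8. At least 5 is left in both cases, for a total of
    [6 * expR (- (5 * u))], and [expR 4 >= 16] absorbs the 6. *)
Lemma union_bound_le (u : R) (l N : nat) : 1 <= u -> u <= (2 ^ l)%:R ->
  (2 ^ l)%:R <= 2 * u -> (l <= N)%N ->
  (2 ^ (2 ^ l))%:R * (2 * expR (- (8 * u))) +
  \sum_(l <= n < N) (2 ^ (2 ^ n.+1) * 2 ^ (2 ^ n))%:R *
     (2 * expR (- (8 * (2 ^ n)%:R))) <= expR (- u).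
Proof.
move=> u1 ul lu lN.
apply: le_trans (_ : 2 * expR (- (5 * u)) + 4 * expR (- (5 * u)) <= _); last first.
  have -> : expR (- (5 * u)) = expR (- u) * expR (- (4 * u)).
    by rewrite -expRD; congr expR; ring.
  have : expR (- (4 * u)) <= 6^-1.
    rewrite expRN lef_pV2 ?posrE ?expR_gt0//.
    apply: le_trans (_ : expR (4%:R * 1) <= _); last by rewrite ler_expR; lra.
    rewrite expRM_natl; have := expR1_ge2; move: (expR 1) => x x2.
    have : 4 <= x ^+ 2 by nra.
    have -> : x ^+ 4 = x ^+ 2 ^+ 2 by ring.
    by move: (x ^+ 2) => y; nra.
  have := expR_gt0 (- u); nra.
apply: lerD.
  apply: le_trans (_ : expR (2 * u) * (2 * expR (- (8 * u))) <= _).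
    rewrite ler_wpM2r ?mulr_ge0 ?expR_ge0//.
    by apply: le_trans (expR_nat_ge _) _; rewrite ler_expR.
  rewrite mulrCA -expRD ler_wpM2l// ler_expR. lra.
apply: le_trans (_ : \sum_(l <= n < N) 2 * expR (- (5 * (2 ^ n)%:R)) <= _).
  apply: ler_sum => n _.
  have -> : expR (- (5 * (2 ^ n)%:R)) =
      expR (2 ^ n.+1)%:R * expR (2 ^ n)%:R * expR (- (8 * (2 ^ n)%:R)) :> R.
    by rewrite -!expRD; congr expR; rewrite expnS natrM; ring.
  rewrite mulrCA ler_wpM2l// ler_wpM2r ?expR_ge0// natrM.
  by apply: ler_pM; rewrite ?ler0n ?expR_nat_ge.
apply: le_trans (sum_expR_pow2 lN) _.
apply: le_trans (_ : 4 * expR (- (5 * (2 ^ l)%:R)) <= _).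
  by rewrite lerBlDr lerDl mulr_ge0 ?expR_ge0.
rewrite ler_wpM2l// ler_expR; lra.
Qed.

End union_bound.

(** * The exceptional event *)

Section bad_event.
Context {d d' : measure_display} {Omega : measurableType d}
  {Theta : measurableType d'} {R : realType} (P : probability Omega R).
Context (m : nat) (X : 'I_m -> {RV P >-> Theta}) (indepX : independent_RVs X).
Hypothesis m0 : (0 < m)%N.
Variables (u rho sigma K : R) (l N : nat) (Pi : nat -> seq (Theta -> R))
  (D : (Theta -> R) -> (Theta -> R) -> R).
Hypotheses (u1 : (1 <= u)%R) (rho0 : (0 < rho)%R) (sigma0 : (0 < sigma)%R)
  (K0 : (0 < K)%R) (D0 : forall g h, (0 < D g h)%R).
Hypotheses (ul : (u <= (2 ^ l)%:R)%R) (lu : ((2 ^ l)%:R <= 2 * u)%R)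
  (lN : (l <= N)%N).
Hypothesis size_Pi : forall n, (n <= N)%N -> (size (Pi n) <= 2 ^ (2 ^ n))%N.
Let F g := exists2 n, (n <= N)%N & g \in Pi n.
Hypothesis mF : forall g, F g -> measurable_fun setT g.
Hypothesis F_rho : forall g, F g -> forall i,
  'E_P[fun w => expR (g (X i w) ^+ 2 / rho ^+ 2)]%R <= 2%:E.
Hypothesis F_D : forall g h, F g -> F h -> forall i,
  'E_P[fun w => expR ((g (X i w) - h (X i w)) ^+ 2 / D g h ^+ 2)]%R <= 2%:E.
Hypothesis F_moment : forall g, F g -> forall q : nat, (2 <= q)%N ->
  (m%:R^-1)%:E * \sum_(i < m)
     'E_P[fun w => (`|g (X i w) ^+ 2 - second_moment X g i| ^+ q)%R]
  <= (q`!%:R / 2 * sigma ^+ 2 * K ^+ (q - 2))%:E.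

Let tn (n : nat) : R := (8 * (2 ^ n)%:R)%R.

Let B0 g := [set w | 2 * sigma * Num.sqrt (m%:R * (8 * u)) + 4 * K * (8 * u) <=
  `|square_sum X g w|]%R.

Let B1 n (gh : (Theta -> R) * (Theta -> R)) := [set w |
  if (2 ^ n <= m)%N then
    16 * rho * D gh.1 gh.2 * Num.sqrt (m%:R * tn n) + 8 * rho * D gh.1 gh.2 * tn n
      <= `|square_sum X gh.1 w - square_sum X gh.2 w|
  else (m%:R + tn n) * D gh.1 gh.2 ^+ 2 <=
      \sum_i (gh.1 (X i w) - gh.2 (X i w)) ^+ 2]%R.

(** All pairs from adjacent levels are taken, whichever chains use them, so that the event does not
    depend on the endpoint [f]. *)
Let pairs n := [seq (g, h) | g <- Pi n.+1, h <- Pi n].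

Let bad := \big[setU/set0]_(g <- Pi l) B0 g `|`
  \big[setU/set0]_(n <- index_iota l N) \big[setU/set0]_(gh <- pairs n) B1 n gh.

Let mB0 g : F g -> measurable (B0 g).
Proof.
move=> /mF mg; apply: measurable_set_ge; apply: measurableT_comp => //.
exact: measurable_square_sum.
Qed.

Let mB1 n gh : F gh.1 -> F gh.2 -> measurable (B1 n gh).
Proof.
move=> /mF m1 /mF m2; rewrite /B1; case: (2 ^ n <= m)%N.
  apply: measurable_set_ge; apply: measurableT_comp => //.
  by apply: measurable_funB; exact: measurable_square_sum.
apply: measurable_set_ge; apply: measurable_sum => i; apply: measurable_funX.
by apply: measurable_funB; exact: measurableT_comp.
Qed.

Let pairsP n gh : (l <= n < N)%N -> gh \in pairs n -> F gh.1 /\ F gh.2.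
Proof.
move=> /andP[_ nN] /allpairsP[[g h] [/= gP hP ->]] /=; split.
  by exists n.+1.
by exists n => //; exact: ltnW.
Qed.

Let PB1 n gh : F gh.1 -> F gh.2 -> P (B1 n gh) <= (2 * expR (- tn n))%:E.
Proof.
move=> F1 F2; have tn0 : (0 < tn n)%R by rewrite mulr_gt0// ltr0n expn_gt0.
rewrite /B1; case: (2 ^ n <= m)%N.
  apply: square_sum_sub_tail => //; [exact: mF|exact: mF|exact: F_rho|
    exact: F_rho|exact: F_D].
(* The one-sided tail is doubled so that both regimes share one bound. *)
apply: le_trans (_ : (expR (- tn n))%:E <= _); last first.
  by rewrite lee_fin ler_peMl ?expR_ge0// ler1n.
have := @square_sum_tail _ _ _ _ _ P m X indepX
  (fun _ x => gh.1 x - gh.2 x)%R (D gh.1 gh.2) (tn n) (D0 _ _).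
apply; last exact: F_D.
by move=> _; apply: measurable_funB; exact: mF.
Qed.

(** Collects all randomness into one measurable event: outside it every estimate holds
    simultaneously, and the rest of the argument is made for a fixed [w]. *)
Lemma bad_event_exists : exists bad : set Omega, [/\ measurable bad,
  P bad <= (expR (- u))%:E,
  forall w, ~ bad w -> forall g, g \in Pi l ->
    (`|square_sum X g w| <=
      2 * sigma * Num.sqrt (m%:R * (8 * u)) + 4 * K * (8 * u))%R,
  forall w, ~ bad w -> forall n g h, (l <= n < N)%N -> (2 ^ n <= m)%N ->
    g \in Pi n.+1 -> h \in Pi n ->
    (`|square_sum X g w - square_sum X h w| <=
     16 * rho * D g h * Num.sqrt (m%:R * (8 * (2 ^ n)%:R)) +
     8 * rho * D g h * (8 * (2 ^ n)%:R))%R &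
  forall w, ~ bad w -> forall n g h, (l <= n < N)%N -> (m < 2 ^ n)%N ->
    g \in Pi n.+1 -> h \in Pi n ->
    (\sum_i (g (X i w) - h (X i w)) ^+ 2 <=
      (m%:R + 8 * (2 ^ n)%:R) * D g h ^+ 2)%R].
Proof.
have FPi n g : (n <= N)%N -> g \in Pi n -> F g by exists n.
have mbig0 : measurable (\big[setU/set0]_(g <- Pi l) B0 g).
  by rewrite big_seq; apply: bigsetU_measurable => g /(FPi _ _ lN); exact: mB0.
have mbig1 n : (l <= n < N)%N ->
    measurable (\big[setU/set0]_(gh <- pairs n) B1 n gh).
  move=> lnN; rewrite big_seq; apply: bigsetU_measurable => gh.
  by move=> /(pairsP lnN)[]; exact: mB1.
have mbig : measurable (\big[setU/set0]_(n <- index_iota l N)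
    \big[setU/set0]_(gh <- pairs n) B1 n gh).
  rewrite big_seq; apply: bigsetU_measurable => n.
  by rewrite mem_index_iota => /mbig1.
have notbad1 w n g h : ~ bad w -> (l <= n < N)%N -> g \in Pi n.+1 ->
    h \in Pi n -> ~ B1 n (g, h) w.
  move=> nb lnN gP hP bw; apply: nb; right.
  rewrite -bigcup_seq; exists n; first by rewrite /= mem_index_iota.
  rewrite -bigcup_seq; exists (g, h) => //=.
  by apply/allpairsP; exists (g, h).
exists bad; split.
- exact: measurableU.
- apply: le_trans (measureU2 _ mbig0 mbig) _ => //.
  apply: le_trans (lee_tofin (union_bound_le u1 ul lu lN)).
  rewrite EFinD; apply: leeD.
    apply: le_trans (_ : ((size (Pi l))%:R * (2 * expR (- (8 * u))))%:E <= _).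
      apply: measure_bigcup_seq_le => g /(FPi _ _ lN) Fg; first exact: mB0.
      apply: (square_sum_tail0 indepX m0 (mF Fg) rho0 sigma0 K0 _ (F_rho Fg)).
        by rewrite mulr_gt0// (lt_le_trans ltr01).
      exact: F_moment.
    by rewrite lee_fin ler_wpM2r ?mulr_ge0 ?expR_ge0// ler_nat size_Pi.
  rewrite -sumEFin.
  have sub (r : seq nat) : all (fun n => l <= n < N)%N r ->
      P (\big[setU/set0]_(n <- r) \big[setU/set0]_(gh <- pairs n) B1 n gh) <=
      \sum_(n <- r) ((2 ^ (2 ^ n.+1) * 2 ^ (2 ^ n))%:R *
        (2 * expR (- (8 * (2 ^ n)%:R))))%:E.
    elim: r => [_|n r IH /= /andP[lnN lr]]; first by rewrite !big_nil measure0.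
    rewrite !big_cons; apply: le_trans (measureU2 _ _ _) _ => //.
    - exact: mbig1.
    - rewrite big_seq; apply: bigsetU_measurable => k /(allP lr); exact: mbig1.
    - apply: leeD; last exact: IH.
      apply: le_trans (_ : ((size (pairs n))%:R * (2 * expR (- tn n)))%:E <= _).
        apply: measure_bigcup_seq_le => gh /(pairsP lnN)[F1 F2].
          exact: mB1.
        exact: PB1.
      rewrite lee_fin ler_wpM2r ?mulr_ge0 ?expR_ge0// ler_nat size_allpairs.
      case/andP: lnN => _ nN; apply: leq_mul; apply: size_Pi => //.
      exact: ltnW.
  by apply: sub; apply/allP => n; rewrite mem_index_iota.
- move=> w nb g gP; rewrite leNgt; apply/negP => h; apply: nb; left.
  by rewrite -bigcup_seq; exists g => //=; exact: ltW.
- move=> w nb n g h lnN nm gP hP; rewrite leNgt; apply/negP => gh.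
  by apply: (notbad1 _ _ _ _ nb lnN gP hP); rewrite /B1/= nm ltW.
- move=> w nb n g h lnN nm gP hP; rewrite leNgt; apply/negP => gh.
  by apply: (notbad1 _ _ _ _ nb lnN gP hP); rewrite /B1/= leqNgt nm/= ltW.
Qed.

End bad_event.

(** * Chains of near-optimal approximations *)

Section gamma2_chain.
Context {R : realType} {T : choiceType}.
Implicit Types (F : set T) (d : T -> T -> \bar R).

(** A near-optimal admissible sequence with near-closest points in each set. It is cut at a level
    [N] large enough to hold all of [F], so that the chain ends exactly at [f]. *)
Lemma gamma2_chain F d (N : nat) (eps : R) :
  finite_set F -> (size (finmap.enum_fset (fset_set F)) <= 2 ^ (2 ^ N))%N ->
  (forall f g, 0 <= d f g) -> (forall f g, F f -> F g -> d f g < +oo) ->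
  (forall f, d f f = 0) ->
  gamma2 F d < +oo -> (0 < eps)%R ->
  exists (Pi : nat -> seq T) (pi : nat -> T -> T), [/\
    forall n, (n <= N)%N -> (size (Pi n) <= 2 ^ (2 ^ n))%N,
    forall n g, g \in Pi n -> F g,
    forall n f, F f -> pi n f \in Pi n,
    forall f, pi N f = f &
    forall f, F f -> (\sum_(0 <= n < N.+1) 2 `^ (n%:R / 2) * fine (d f (pi n f))
      <= fine (gamma2 F d) + eps)%R].
Proof.
move=> finF sizeF d0 doo d00 goo eps0.
have dist0 f G : 0 <= dist_to d f G.
  by apply: le_ereal_inf_tmp => _ [g _ <-].
have q0 n : (0 <= 2 `^ (n%:R / 2) :> R)%R by exact: powR_ge0.
have S0 (Fn : nat -> set T) f n : 0 <= (2 `^ (n%:R / 2))%:E * dist_to d f (Fn n).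
  by apply: mule_ge0; rewrite ?lee_fin.
have [F0|] := pselect (F = set0).
  subst F; exists (fun=> [::]), (fun _ f => f); split => //.
move=> /eqP/set0P[f0 Ff0].
have g0 : 0 <= gamma2 F d.
  apply: le_ereal_inf_tmp => _ [Fn _ <-].
  apply: le_trans (_ : _ <= _) (ereal_sup_ubound _); last by exists f0; first exact: Ff0.
  by apply: nneseries_ge0 => n _ _; exact: S0.
have gfin : gamma2 F d \is a fin_num by rewrite ge0_fin_numE.
have e20 : (0 < eps / 2)%R by rewrite divr_gt0.
have [_ [Fn [FnF Fn0 Fn1 Fncard] <-] FnG] := lb_ereal_inf_adherent e20 gfin.
(* Half of [eps] pays for the admissible sequence. The other half is spread over the levels as
   [e = eps / 2 / Q], whose weighted total is at most [eps / 2]; the summand 1 keeps [Q] positive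
   when [N = 0]. *)
pose Q : R := (1 + \sum_(0 <= n < N) 2 `^ (n%:R / 2))%R.
have Q0 : (0 < Q)%R by rewrite ltr_pwDl// sumr_ge0.
pose e : R := (eps / 2 / Q)%R.
have e0 : (0 < e)%R by rewrite !divr_gt0.
have /choice[pi' pi'P] : forall nf : nat * T, exists g, F nf.2 -> (nf.1 < N)%N ->
    Fn nf.1 g /\ d nf.2 g < dist_to d nf.2 (Fn nf.1) + e%:E.
  move=> [n f] /=; have [Ff|nFf] := pselect (F f); last by exists f.
  have [h Fnh] := Fn0 n.
  have dfin : dist_to d f (Fn n) \is a fin_num.
    rewrite ge0_fin_numE//; apply: le_lt_trans (doo f h Ff (FnF _ _ Fnh)).
    by apply: ereal_inf_lbound; exists h.
  have [_ [g Fng <-] gd] := lb_ereal_inf_adherent e0 dfin.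
  by exists g.
have finFn n : finite_set (Fn n) by exact: sub_finite_set (FnF n) finF.
exists (fun n => if (n < N)%N then finmap.enum_fset (fset_set (Fn n))
  else finmap.enum_fset (fset_set F)).
exists (fun n f => if (n < N)%N then pi' (n, f) else f).
split.
- move=> n nN; case: ifPn => [_|].
    case: n nN => [_|n _].
      (* Level 0 has one point, which fits the uniform bound [2 ^ (2 ^ 0) = 2]. *)
      apply: leq_trans (_ : 1 <= _)%N; last by rewrite expn_gt0.
      by apply: geq_card_fset_set; move: Fn1; rewrite card_eq_le => /andP[].
    by apply: geq_card_fset_set; apply: Fncard.
  by rewrite -leqNgt => Nn; rewrite (_ : n = N)//; apply/eqP; rewrite eqn_leq nN.
- move=> n g; case: ifPn => _.
    by rewrite in_fset_set// inE => /FnF.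
  by rewrite in_fset_set// inE.
- move=> n f Ff; case: ifPn => nN.
    by rewrite in_fset_set// inE; have [] := pi'P (n, f) Ff nN.
  by rewrite in_fset_set// inE.
- by move=> f; rewrite ltnn.
move=> f Ff; rewrite big_nat_recr//= ltnn d00 mulr0 addr0.
rewrite -lee_fin EFinD fineK// -sumEFin.
apply: le_trans (_ : \sum_(0 <= n < N)
  ((2 `^ (n%:R / 2))%:E * dist_to d f (Fn n) + (2 `^ (n%:R / 2) * e)%:E) <= _).
  rewrite big_nat [leRHS]big_nat; apply: lee_sum => n /andP[_ nN]; rewrite nN.
  have [Fg dg] := pi'P (n, f) Ff nN; rewrite /= in Fg dg *.
  rewrite EFinM fineK; last by rewrite ge0_fin_numE// doo//; exact: FnF Fg.
  apply: le_trans (_ : (2 `^ (n%:R / 2))%:E * (dist_to d f (Fn n) + e%:E) <= _).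
    by rewrite lee_wpmul2l ?lee_fin// ltW.
  by rewrite ge0_muleDr// lee_fin ltW.
rewrite big_split/= sumEFin -mulr_suml.
have -> : eps%:E = (eps / 2)%:E + (eps / 2)%:E by rewrite -EFinD; congr EFin; field.
rewrite addeA; apply: leeD; last first.
  rewrite lee_fin /e mulrCA ger_pMr// ler_pdivrMr// mul1r /Q.
  by rewrite lerDr.
apply: le_trans (ltW FnG).
apply: le_trans (ereal_sup_ubound _); last by exists f; first exact: Ff.
by apply: nneseries_lim_ge => n _ _; exact: S0.
Qed.

End gamma2_chain.

(** * The psi_2-distance and radius on a class of functions *)

Section psi2_dist.
Context {d d' : measure_display} {Omega : measurableType d}
  {Theta : measurableType d'} {R : realType} (P : probability Omega R).
Context (m : nat) (X : 'I_m -> {RV P >-> Theta}).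
Implicit Types f g h : Theta -> R.

Lemma psi2_norm_le_dist f g i :
  psi2_norm P (fun w => f (X i w) - g (X i w))%R <= psi2_dist X f g.
Proof.
exact: (le_bigmax _ (fun i => psi2_norm P (fun w => f (X i w) - g (X i w))%R)).
Qed.

Lemma psi2_dist_ge0 f g : 0 <= psi2_dist X f g.
Proof. exact: bigmax_ge_id. Qed.

Lemma psi2_norm0 : psi2_norm P (fun=> 0%R) = 0.
Proof.
apply/eqP; rewrite eq_le psi2_norm_ge0 andbT; apply/lee_addgt0Pr => e e0.
rewrite add0e; apply: psi2_norm_le => //.
under eq_fun do rewrite expr0n mul0r expR0.
by rewrite expectation_cst lee_fin ler1n.
Qed.

Lemma psi2_dist_refl f : psi2_dist X f f = 0.
Proof.
apply/eqP; rewrite eq_le psi2_dist_ge0 andbT; apply: bigmax_le => // i _.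
by under eq_fun do rewrite subrr; rewrite psi2_norm0.
Qed.

(** Both distances on the right start at [f], the form in which two successive points of the chain
    of [f] are compared. *)
Lemma psi2_dist_triangle f g h : measurable_fun setT f ->
  measurable_fun setT g -> measurable_fun setT h ->
  psi2_dist X g h <= 2%:E * (psi2_dist X f g + psi2_dist X f h).
Proof.
move=> mf mg mh; apply: bigmax_le => [|i _].
  by apply: mule_ge0 => //; apply: adde_ge0; exact: psi2_dist_ge0.
apply: le_trans (_ : 2%:E * (psi2_norm P (fun w => f (X i w) - g (X i w))%R +
   psi2_norm P (fun w => f (X i w) - h (X i w))%R) <= _).
  apply: psi2_norm_le_add => [|||w].
  - by apply: measurable_funB; exact: measurableT_comp.
  - by apply: measurable_funB; exact: measurableT_comp.
  - by apply: measurable_funB; exact: measurableT_comp.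
  - rewrite -[X in (_ <= X + _)%R]normrN; apply: le_trans (ler_normD _ _).
    by rewrite le_eqVlt; apply/orP; left; apply/eqP; congr (`|_|)%R; ring.
by rewrite lee_wpmul2l// leeD// psi2_norm_le_dist.
Qed.

Lemma psi2_dist_lty f g : measurable_fun setT f -> measurable_fun setT g ->
  (forall i, subgaussian P (fun w => f (X i w))) ->
  (forall i, subgaussian P (fun w => g (X i w))) ->
  psi2_dist X f g < +oo.
Proof.
move=> mf mg sf sg; apply: bigmax_lt; first exact: ltry.
move=> i _; apply: le_lt_trans (_ : 2%:E * (psi2_norm P (fun w => f (X i w)) +
   psi2_norm P (fun w => g (X i w))) < _).
  apply: psi2_norm_le_add => [|||w].
  - exact: measurableT_comp.
  - exact: measurableT_comp.
  - by apply: measurable_funB; exact: measurableT_comp.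
  - exact: ler_normB.
by apply: lte_mul_pinfty => //; apply: lte_add_pinfty; [exact: sf|exact: sg].
Qed.

Lemma psi2_radius_lty (F : set (Theta -> R)) : finite_set F ->
  (forall f, F f -> forall i, subgaussian P (fun w => f (X i w))) ->
  psi2_radius X F < +oo.
Proof.
move=> /finite_seqP[s ->] sF.
apply: le_lt_trans (_ : \big[maxe/0]_(f <- s)
  \big[maxe/0]_(i < m) psi2_norm P (fun w => f (X i w)) < _).
  apply: ge_ereal_sup => _ [f fs <-].
  exact: (le_bigmax_seq _ f xpredT (fun f : Theta -> R =>
    \big[maxe/0]_(i < m) psi2_norm P (fun w => f (X i w)))).
rewrite big_seq; apply: bigmax_lt; first exact: ltry.
move=> f fs; apply: bigmax_lt; first exact: ltry.
by move=> i _; exact: sF.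
Qed.

Lemma psi2_norm_le_radius (F : set (Theta -> R)) f i : F f ->
  psi2_norm P (fun w => f (X i w)) <= psi2_radius X F.
Proof.
move=> Ff; apply: le_trans (_ : \big[maxe/0]_(i < m)
    psi2_norm P (fun w => f (X i w)) <= _).
  exact: (le_bigmax _ (fun i => psi2_norm P (fun w => f (X i w)))).
by apply: ereal_sup_ubound; exists f.
Qed.

End psi2_dist.

(** * Suprema over a finite class *)

Section finite_sup.
Context {d : measure_display} {Omega : measurableType d} {R : realType}
  {T : choiceType}.

(** Over a finite set the strict inequality survives the supremum; [-oo < c] covers the empty
    one. *)
Lemma ereal_sup_finite_lt (F : set T) (z : T -> R) (c : \bar R) :
  finite_set F -> -oo < c -> (forall f, F f -> (z f)%:E < c) ->
  ereal_sup [set (z f)%:E | f in F] < c.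
Proof.
move=> /finite_seqP[s ->] c0 zc.
apply: le_lt_trans (_ : \big[maxe/-oo]_(f <- s) (z f)%:E < _).
  apply: ge_ereal_sup => _ [f fs <-].
  exact: (le_bigmax_seq _ f xpredT (fun f => (z f)%:E)).
by rewrite big_seq; apply: bigmax_lt.
Qed.

Lemma measurable_ge_ereal_sup (F : set T) (Z : T -> Omega -> R) (c : R) :
  finite_set F -> (forall f, F f -> measurable_fun setT (Z f)) ->
  measurable [set w | c%:E <= ereal_sup [set (Z f w)%:E | f in F]].
Proof.
move=> finF mZ.
have -> : [set w | c%:E <= ereal_sup [set (Z f w)%:E | f in F]] =
    \bigcup_(f in F) [set w | c <= Z f w]%R.
  apply/seteqP; split => w /=.
    move=> cF; apply: contrapT => h.
    move: cF; rewrite leNgt => /negP; apply.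
    apply: ereal_sup_finite_lt => //; first exact: ltNyr.
    move=> f Ff; rewrite lte_fin ltNge.
    by apply/negP => cZ; apply: h; exists f.
  move=> [f Ff cZ]; apply: le_trans (_ : (Z f w)%:E <= _).
    by rewrite lee_fin.
  by apply: ereal_sup_ubound; exists f.
by apply: fin_bigcup_measurable => // f Ff; apply: measurable_set_ge; exact: mZ.
Qed.

End finite_sup.

Lemma exists_pow2_between {R : realType} (u : R) : (1 <= u)%R ->
  exists l : nat, (u <= (2 ^ l)%:R)%R /\ ((2 ^ l)%:R <= 2 * u)%R.
Proof.
move=> u1.
have ex : exists n : nat, (u <= (2 ^ n)%:R)%R.
  exists (Num.truncn u).+1; apply/ltW/(lt_trans (truncnS_gt u)).
  by rewrite ltr_nat; exact: ltn_expl.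
case: (ex_minnP ex) => l ul lmin; exists l; split => //.
case: l ul lmin => [|l] ul lmin; first by rewrite expn0; lra.
rewrite expnS natrM ler_wpM2l// leNgt; apply/negP => /ltW /lmin.
by rewrite ltnn.
Qed.

Lemma sqr_powR_half {R : realType} (n : nat) :
  ((2 `^ (n%:R / 2)) ^+ 2 = 2 ^+ n :> R)%R.
Proof.
by rewrite -powR_mulrn ?powR_ge0// -powRrM divfK ?powR_mulrn.
Qed.

Lemma exists_small {R : realType} (c b : R) : (0 < c)%R -> (0 < b)%R ->
  exists eps : R, [/\ 0 < eps, eps <= 1 & c * eps <= b]%R.
Proof.
move=> c0 b0; have [h|/ltW h] := leP (b / c)%R (1 : R)%R.
  exists (b / c)%R; split => //; first exact: divr_gt0.
  by rewrite mulrC divfK// lt0r_neq0.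
exists (1 : R)%R; split => //.
by move: h; rewrite ler_pdivlMr// mul1r mulr1.
Qed.

(** * The uniform bound for the centred sums of squares *)

Section square_process_tail.
Context {d d' : measure_display} {Omega : measurableType d}
  {Theta : measurableType d'} {R : realType} (P : probability Omega R).
Context (m : nat) (X : 'I_m -> {RV P >-> Theta}) (indepX : independent_RVs X).
Hypothesis m0 : (0 < m)%N.
Variables (F : set (Theta -> R)) (sigma K gamma r u : R).
Hypothesis finF : finite_set F.
Hypothesis mF : forall f, F f -> measurable_fun [set: Theta] f.
Hypothesis sF : forall f, F f -> forall i, subgaussian P (fun w => f (X i w)).
Hypotheses (sigma0 : (0 < sigma)%R) (K0 : (0 < K)%R) (u1 : (1 <= u)%R).
Hypothesis F_moment : forall g, F g -> forall q : nat, (2 <= q)%N ->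
  (m%:R^-1)%:E * \sum_(i < m)
     'E_P[fun w => (`|g (X i w) ^+ 2 - second_moment X g i| ^+ q)%R]
  <= (q`!%:R / 2 * sigma ^+ 2 * K ^+ (q - 2))%:E.
Hypotheses (gammaE : gamma2 F (psi2_dist X) = gamma%:E)
  (rE : psi2_radius X F = r%:E) (gamma0 : (0 <= gamma)%R) (r0 : (0 <= r)%R).

Let mu : R := Num.sqrt m%:R.

(** In [gamma + 2 * eps] one [eps] pays for the near-optimal chain and the other for enlarging all
    distances; [r + eps] lies strictly above the radius, as [psi2_norm_exp] requires. *)
Lemma square_sum_sup_eps (eps : R) : (0 < eps)%R ->
  exists bad : set Omega, [/\ measurable bad, P bad <= (expR (- u))%:E &
  forall w, ~ bad w -> forall f, F f ->
  (`|square_sum X f w| <=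
    2 * (2 * sigma * Num.sqrt (m%:R * (8 * u)) + 4 * K * (8 * u)) +
    1068 * ((gamma + 2 * eps) ^+ 2 + (r + eps) * mu * (gamma + 2 * eps)))%R].
Proof.
move=> eps0.
have mu0 : (0 < mu)%R by rewrite sqrtr_gt0 ltr0n.
have mu2 : (mu ^+ 2 = m%:R)%R by rewrite sqr_sqrtr.
have [l [ul lu]] := exists_pow2_between u1.
pose N := maxn l (size (finmap.enum_fset (fset_set F))).
have lN : (l <= N)%N by exact: leq_maxl.
have sizeF : (size (finmap.enum_fset (fset_set F)) <= 2 ^ (2 ^ N))%N.
  apply: leq_trans (leq_maxr l _) _; apply: ltnW.
  by apply: ltn_trans (ltn_expl _ _) (ltn_expl _ _).
have doo f g : F f -> F g -> psi2_dist X f g < +oo.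
  move=> Ff Fg; exact: (psi2_dist_lty (mF Ff) (mF Fg) (sF Ff) (sF Fg)).
have goo : gamma2 F (psi2_dist X) < +oo by rewrite gammaE ltry.
have [Pi [pi [size_Pi PiF piPi piN]]] := gamma2_chain finF sizeF
  (psi2_dist_ge0 X) doo (psi2_dist_refl X) goo eps0.
rewrite gammaE /= => sum_pi.
pose q n : R := (2 `^ (n%:R / 2))%R.
have q0 n : (0 < q n)%R by exact: powR_gt0.
have q2 n : (q n ^+ 2 = 2 ^+ n)%R by exact: sqr_powR_half.
have qS n : (q n <= q n.+1)%R.
  by rewrite -ler_sqr ?nnegrE ?(ltW (q0 _))// !q2 ler_eXn2l ?ltr1n.
pose Q : R := (1 + \sum_(0 <= n < N.+1) q n)%R.
have Q1 : (1 <= Q)%R by rewrite lerDl sumr_ge0// => n _; exact: ltW.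
have Q0 : (0 < Q)%R by exact: lt_le_trans Q1.
(* Added to every distance to make it strict and positive; weighted by [q n] over all levels it
   costs at most [eps]. *)
pose eta : R := (eps / Q)%R.
have eta0 : (0 < eta)%R by rewrite divr_gt0.
pose D g h : R := (fine (psi2_dist X g h) + eta)%R.
have fine_d0 g h : (0 <= fine (psi2_dist X g h))%R.
  by rewrite fine_ge0// psi2_dist_ge0.
have D0 g h : (0 < D g h)%R by rewrite ltr_wpDl.
have dE g h : F g -> F h -> psi2_dist X g h = (fine (psi2_dist X g h))%:E.
  by move=> Fg Fh; rewrite fineK// ge0_fin_numE ?psi2_dist_ge0//; exact: doo.
pose rho : R := (r + eps)%R.
have rho0 : (0 < rho)%R by rewrite ltr_wpDl.
have F_rho g : F g -> forall i,
    'E_P[fun w => expR (g (X i w) ^+ 2 / rho ^+ 2)]%R <= 2%:E.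
  move=> Fg i; apply: (psi2_norm_exp (Y := fun w => g (X i w))).
    by apply: measurableT_comp => //; exact: mF.
  apply: le_lt_trans (psi2_norm_le_radius X i Fg) _.
  by rewrite rE lte_fin ltrDl.
have F_D g h : F g -> F h -> forall i,
    'E_P[fun w => expR ((g (X i w) - h (X i w)) ^+ 2 / D g h ^+ 2)]%R <= 2%:E.
  move=> Fg Fh i; apply: (psi2_norm_exp (Y := fun w => g (X i w) - h (X i w))%R).
    by apply: measurable_funB; apply: measurableT_comp => //; exact: mF.
  apply: le_lt_trans (psi2_norm_le_dist X g h i) _.
  by rewrite dE// lte_fin ltrDl.
have PiF' g : (exists2 n, (n <= N)%N & g \in Pi n) -> F g.
  by move=> [n _ /PiF].
have [bad [mbad Pbad bad0 bad1 bad2]] := @bad_event_exists _ _ _ _ _ P m X indepX m0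
  u rho sigma K l N Pi D u1 rho0 sigma0 K0 D0 ul lu lN size_Pi
  (fun g h => mF (PiF' g h)) (fun g h => F_rho g (PiF' g h))
  (fun g h pg ph => F_D g h (PiF' g pg) (PiF' h ph))
  (fun g h => F_moment (PiF' g h)).
exists bad; split => // w nbad f Ff.
pose a n i := pi n f (X i w).
pose s n i := second_moment X (pi n f) i.
pose e n := D f (pi n f).
pose De n := D (pi n.+1 f) (pi n f).
pose G : R := (gamma + 2 * eps)%R.
have G0 : (0 < G)%R by rewrite ltr_wpDl// mulr_gt0.
have Fpi n : F (pi n f) by apply: (PiF n); exact: piPi.
have sum_e : (\sum_(0 <= n < N.+1) q n * e n <= G)%R.
  under eq_bigr do rewrite mulrDr.
  rewrite big_split/= -mulr_suml.
  have : (\sum_(0 <= n < N.+1) q n * eta <= eps)%R.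
    rewrite -mulr_suml mulrC /eta mulrAC ler_pdivrMr// ler_pM2l//.
    by rewrite /Q lerDr.
  rewrite -mulr_suml => h; have := sum_pi f Ff; rewrite /G; lra.
have e0 n : (0 <= e n)%R by exact/ltW/D0.
have qe0 n : (0 <= q n * e n)%R by rewrite mulr_ge0// ltW.
have De_le n : (De n <= 2 * (e n + e n.+1))%R.
  have := psi2_dist_triangle X (mF Ff) (mF (Fpi n.+1)) (mF (Fpi n)).
  rewrite (dE _ _ (Fpi n.+1) (Fpi n)) (dE _ _ Ff (Fpi n)) (dE _ _ Ff (Fpi n.+1)).
  rewrite -EFinD -EFinM lee_fin /De /e /D; lra.
have := @chaining_le R m l N a s q De e mu rho G
  (2 * sigma * Num.sqrt (m%:R * (8 * u)) + 4 * K * (8 * u))%R.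
cbv zeta beta.
have TE n : (\sum_i (a n i ^+ 2 - s n i) = square_sum X (pi n f) w)%R by [].
rewrite !TE piN.
apply => //; first by move=> n; exact: D0.
(* As [q n <= q n.+1], a link costs twice the weighted distances from [f] at its two ends, and each
   of the two resulting sums is at most [G]. *)
- apply: le_trans (_ : \sum_(l <= n < N) (2 * (q n * e n) + 2 * (q n.+1 * e n.+1)) <= _)%R.
    apply: ler_sum => n _.
    apply: le_trans (ler_wpM2l (ltW (q0 n)) (De_le n)) _.
    have := ler_wpM2r (ltW (D0 f (pi n.+1 f))) (qS n); rewrite -/(e _); lra.
  rewrite big_split/= -!mulr_sumr.
  have A1 : (\sum_(l <= n < N) q n * e n <= G)%R.
    apply: le_trans sum_e; rewrite [leRHS](big_cat_nat (n := l))//=; last first.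
      exact: leq_trans lN _.
    rewrite [X in (_ <= _ + X)%R](big_cat_nat (n := N))//=.
    by rewrite addrCA lerDl addr_ge0// sumr_ge0.
  have A2 : (\sum_(l <= n < N) q n.+1 * e n.+1 <= G)%R.
    rewrite -(big_add1 _ _ l N.+1 xpredT (fun n => q n * e n)%R).
    apply: le_trans sum_e; rewrite [leRHS](big_cat_nat (n := l.+1))//=.
    by rewrite lerDr sumr_ge0.
  lra.
- move=> n /andP[_ nN]; split; first exact: ltW (D0 _ _).
  apply: le_trans sum_e; rewrite big_mkord.
  rewrite (bigD1 (Ordinal (nN : (n < N.+1)%N)))//= lerDl.
  by rewrite sumr_ge0.
- by move=> n i _; apply: (second_moment_le (mF (Fpi n)) rho0 (F_rho _ (Fpi n) i)).
- move=> n i _; rewrite /s piN.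
  exact: (second_moment_sub_le (mF Ff) (mF (Fpi n)) rho0 (D0 f (pi n f))
    (F_rho _ Ff) (F_rho _ (Fpi n)) (F_D _ _ Ff (Fpi n))).
- by apply: bad0 => //; exact: piPi.
- move=> n lnN nm.
  have := bad1 w nbad n _ _ lnN nm (piPi n.+1 f Ff) (piPi n f Ff).
  move=> /le_trans; apply; rewrite -/(De n).
  have q_mu : (q n <= mu)%R.
    by rewrite -ler_sqr ?nnegrE ?(ltW mu0) ?(ltW (q0 n))// mu2 q2 -natrX ler_nat.
  have -> : (Num.sqrt (m%:R * (8 * (2 ^ n)%:R)) = mu * q n * Num.sqrt 8 :> R)%R.
    rewrite natrX -q2 -mu2 mulrCA [(8 * _)%R]mulrC -exprMn.
    by rewrite sqrtrM ?sqr_ge0// sqrtr_sqr ger0_norm// mulr_ge0 ?ltW.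
  (* With [sqrt 8 <= 3] and [q n <= mu] the two terms contribute [16 * 3] and [8 * 8], together
     112. *)
  have s8 : (Num.sqrt 8 <= 3 :> R)%R.
    by rewrite -ler_sqr ?nnegrE ?sqrtr_ge0// sqr_sqrtr//; lra.
  rewrite natrX -q2.
  have c0 : (0 <= rho * De n * q n)%R by rewrite !mulr_ge0 ?ltW//; exact: D0.
  have h1 : (rho * De n * q n * mu * Num.sqrt 8 <= rho * De n * q n * mu * 3)%R.
    by rewrite ler_wpM2l// mulr_ge0// ltW.
  have h2 : (rho * De n * q n * q n <= rho * De n * q n * mu)%R.
    by rewrite ler_wpM2l.
  lra.
- move=> n lnN nm.
  have := bad2 w nbad n _ _ lnN nm (piPi n.+1 f Ff) (piPi n f Ff).
  move=> /le_trans; apply; rewrite -/(De n).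
  (* In this regime [m + 8 * 2^n <= 9 * 2^n], whence the factor 3. *)
  have -> : ((3 * (q n * De n)) ^+ 2 = (9 * (2 ^ n)%:R) * De n ^+ 2)%R.
    by rewrite natrX -q2; ring.
  rewrite ler_wpM2r ?sqr_ge0//.
  have : (m%:R <= (2 ^ n)%:R :> R)%R by rewrite ler_nat ltnW.
  lra.
Qed.

(** Removes [eps] by choosing it so small that its total cost is at most one [sigma * mu * sqrt u];
    thus 13 is [2 * 2 * 3 + 1], and 64 is [2 * 4 * 8]. *)
Lemma square_sum_sup_tail : exists bad : set Omega,
  [/\ measurable bad, P bad <= (expR (- u))%:E &
  forall w, ~ bad w -> forall f, F f ->
  (`|square_sum X f w| <= 1068 * (gamma ^+ 2 + r * mu * gamma) +
    13 * (sigma * mu * Num.sqrt u) + 64 * (K * u))%R].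
Proof.
have mu0 : (0 < mu)%R by rewrite sqrtr_gt0 ltr0n.
have su0 : (0 < Num.sqrt u)%R by rewrite sqrtr_gt0 (lt_le_trans ltr01).
(* The coefficient of [eps] when the squares and products are expanded and [eps ^+ 2 <= eps] is
   used. *)
pose A : R := (4 * gamma + 4 + mu * (2 * r + gamma + 2))%R.
have A0 : (0 < A)%R.
  have : (0 <= mu * (2 * r + gamma + 2))%R.
    by rewrite mulr_ge0 ?(ltW mu0)// !addr_ge0// mulr_ge0.
  by move=> h; rewrite ltr_wpDr// ltr_wpDl// mulr_ge0.
pose slack : R := (sigma * mu * Num.sqrt u)%R.
have slack0 : (0 < slack)%R by rewrite !mulr_gt0.
have A1 : (0 < 1068 * A)%R by rewrite mulr_gt0 ?ltr0n.
have [eps [eps0 eps1 epsA]] := exists_small A1 slack0.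
have [bad [mbad Pbad H]] := square_sum_sup_eps eps0.
exists bad; split => // w /H {}H f /H /le_trans; apply.
have s8 : (Num.sqrt (m%:R * (8 * u)) <= 3 * (mu * Num.sqrt u))%R.
  rewrite mulrCA sqrtrM// sqrtrM// ler_wpM2r ?mulr_ge0 ?sqrtr_ge0//.
  by rewrite -ler_sqr ?nnegrE ?sqrtr_ge0// sqr_sqrtr//; lra.
have s8' : (sigma * Num.sqrt (m%:R * (8 * u)) <= 3 * slack)%R.
  by apply: le_trans (ler_wpM2l (ltW sigma0) s8) _; rewrite /slack; lra.
have e2 : ((gamma + 2 * eps) ^+ 2 + (r + eps) * mu * (gamma + 2 * eps) <=
    gamma ^+ 2 + r * mu * gamma + eps * A)%R.
  have ee : (eps ^+ 2 <= eps)%R by rewrite expr2 ler_piMl// ltW.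
  have mee : (mu * eps ^+ 2 <= mu * eps)%R by rewrite ler_wpM2l// ltW.
  rewrite /A; lra.
have -> : (sigma * mu * Num.sqrt u = slack)%R by [].
lra.
Qed.

End square_process_tail.

Theorem corollary5p7 (R : realType) :
  exists c C : R, (0 < c)%R /\ (0 < C)%R /\
  forall (d d' : measure_display)
    (Omega : measurableType d) (Theta : measurableType d')
    (P : probability Omega R) (m : nat) (X : 'I_m -> {RV P >-> Theta})
    (F : set (Theta -> R)) (sigma K : R),
    (0 < m)%N ->
    independent_RVs X ->
    finite_set F ->
    F !=set0 ->
    (forall f, F f -> measurable_fun [set: Theta] f) ->
    (forall f, F f -> forall i, subgaussian P (fun w => f (X i w))) ->
    (0 < sigma)%R ->
    (0 < K)%R ->
    (forall q : nat, (2 <= q)%N ->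
      ereal_sup
        [set (m%:R^-1)%:E * \sum_(i < m)
           'E_P[fun w => (`|f (X i w) ^+ 2 - second_moment X f i| ^+ q)%R]
         | f in F]
      <= (q`!%:R / 2 * sigma ^+ 2 * K ^+ (q - 2))%:E) ->
    forall u : R, (1 <= u)%R ->
      P [set w |
          C%:E * ((m%:R^-1)%:E * gamma2 F (psi2_dist X) ^+ 2
                  + psi2_radius X F * ((Num.sqrt m%:R)^-1)%:E
                    * gamma2 F (psi2_dist X))
          + (c * (Num.sqrt u * (sigma / Num.sqrt m%:R) + u * (K / m%:R)))%:E
          <= ereal_sup [set (sq_deviation X f w)%:E | f in F]]
      <= (expR (- u))%:E.
Proof.
(* 65 exceeds both 13 and 64: outside the exceptional event the deviations must lie strictly below
   the threshold, since the event of the theorem is defined by a non-strict inequality. *)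
exists 65%R, 1068%R; do 2![split; first by rewrite ltr0n].
move=> d d' Omega Theta P m X F sigma K m0 indepX finF F0 mF sF sigma0 K0 Hq u u1.
have mu0 : (0 < Num.sqrt m%:R :> R)%R by rewrite sqrtr_gt0 ltr0n.
have m0' : (0 < m%:R :> R)%R by rewrite ltr0n.
have [f0 Ff0] := F0.
have r0 : 0 <= psi2_radius X F.
  apply: le_trans (ereal_sup_ubound _); last by exists f0; first exact: Ff0.
  exact: bigmax_ge_id.
have rE : psi2_radius X F = (fine (psi2_radius X F))%:E.
  by rewrite fineK// ge0_fin_numE// psi2_radius_lty.
have g0 : 0 <= gamma2 F (psi2_dist X).
  apply: le_ereal_inf_tmp => _ [Fn _ <-].
  apply: le_trans (ereal_sup_ubound _); last by exists f0; first exact: Ff0.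
  apply: nneseries_ge0 => n _ _; apply: mule_ge0; first by rewrite lee_fin powR_ge0.
  by apply: le_ereal_inf_tmp => _ [g _ <-]; exact: psi2_dist_ge0.
(* If [gamma2] is infinite, so is the threshold: the squared term is [+oo] and the mixed term is
   nonnegative. The supremum of finitely many reals does not reach it. *)
have [goo|] := ltP (gamma2 F (psi2_dist X)) +oo; last first.
  rewrite leye_eq => /eqP ->.
  rewrite (_ : [set w | _] = set0) ?measure0 ?lee_fin ?expR_ge0//.
  apply/seteqP; split => // w /=.
  rewrite mulyy gt0_muley ?lte_fin ?invr_gt0// addye; last first.
    rewrite -ltNye (lt_le_trans (ltNyr 0%R))//.
    by rewrite mule_ge0// mule_ge0// lee_fin invr_ge0 ltW.
  rewrite gt0_muley ?lte_fin ?ltr0n// addye// leNgt => /negP; apply.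
  by apply: ereal_sup_finite_lt => // f _; exact: ltry.
have gE : gamma2 F (psi2_dist X) = (fine (gamma2 F (psi2_dist X)))%:E.
  by rewrite fineK// ge0_fin_numE.
move: (fine_ge0 g0) (fine_ge0 r0) gE rE.
move: (fine (gamma2 _ _)) (fine (psi2_radius _ _)) => gamma r gamma0 r0' gE rE.
have F_moment g : F g -> forall q : nat, (2 <= q)%N ->
    (m%:R^-1)%:E * \sum_(i < m)
       'E_P[fun w => (`|g (X i w) ^+ 2 - second_moment X g i| ^+ q)%R]
    <= (q`!%:R / 2 * sigma ^+ 2 * K ^+ (q - 2))%:E.
  move=> Fg q q2; apply: le_trans (Hq q q2).
  by apply: ereal_sup_ubound; exists g.
have [bad [mbad Pbad H]] := square_sum_sup_tail indepX m0 finF mF sF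
  sigma0 K0 u1 F_moment gE rE gamma0 r0'.
rewrite gE rE.
set thr : \bar R := (X in [set w | X <= _]).
pose thr' : R := (1068 * (m%:R^-1 * gamma ^+ 2 + r * (Num.sqrt m%:R)^-1 * gamma)
  + 65 * (Num.sqrt u * (sigma / Num.sqrt m%:R) + u * (K / m%:R)))%R.
have -> : thr = thr'%:E by [].
apply: le_trans Pbad; apply: le_measure; rewrite ?inE//.
  apply: measurable_ge_ereal_sup => // f Ff.
  rewrite (_ : sq_deviation X f = fun w => `|square_sum X f w| / m%:R)%R; last first.
    by apply/funext => w; rewrite sq_deviationE.
  apply: measurable_funM => //; apply: measurableT_comp => //.
  by apply: measurable_square_sum; exact: mF.
(* Contraposition: outside the exceptional event every deviation, and hence their finite supremum,
   is below the threshold. *)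
move=> w /= thrw; apply: contrapT => nbad.
move: thrw; rewrite leNgt => /negP; apply.
apply: ereal_sup_finite_lt => // [|f Ff]; first exact: ltNyr.
rewrite lte_fin sq_deviationE ltr_pdivrMr//.
apply: le_lt_trans (H w nbad f Ff) _.
have mE : (m%:R = Num.sqrt m%:R ^+ 2 :> R)%R by rewrite sqr_sqrtr.
have -> : (thr' * m%:R = 1068 * (gamma ^+ 2 + r * Num.sqrt m%:R * gamma) +
    65 * (sigma * Num.sqrt m%:R * Num.sqrt u) + 65 * (K * u))%R.
  rewrite /thr'; move: (Num.sqrt m%:R) mE mu0 => mu -> mu0.
  by field; rewrite lt0r_neq0.
have : (0 < sigma * Num.sqrt m%:R * Num.sqrt u)%R.
  by rewrite !mulr_gt0// sqrtr_gt0 (lt_le_trans ltr01).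
have : (0 < K * u)%R by rewrite mulr_gt0// (lt_le_trans ltr01).
lra.
Qed.
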